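(* Let $l\geq 3$. In $AdS_l$, define the singularity $\mathscr{S}$ as the union of all closed orbits of the Iwasawa subgroup $AN$ and all closed orbits of the Iwasawa subgroup $A\overline{N}$ of $SO(2,l-1)$ acting on $AdS_l$. This definition gives rise to a black hole structure, in the sense that the event horizon (the boundary in $AdS_l$ of the interior region) is non-empty.
   Context: Let $n=l-1$. $AdS_l$ is the set of points $(u,t,x_1,\ldots,x_{l-1})\in\mathbb{R}^{2,l-1}$ with $u^2+t^2-x_1^2-\cdots-x_{l-1}^2=1$; write $x=x_1$, $y=x_2$. Let $G$ be the identity component of $SO(2,n)$ (matrices of size $l+1=n+2$ in the coordinates $(u,t,x,y,x_3,\ldots,x_{l-1})$), acting linearly, and $H$ the stabilizer in $G$ of $o=(1,0,\ldots,0)^T$, so that $AdS_l\cong G/H$ via $\pi(g)=[g]\mapsto g\cdot o$. Iwasawa subgroups: let $E_{ij}$ be the elementary matrix with $1$ in position $(i,j)$. Put $J_1=E_{24}+E_{42}$, $J_2=E_{13}+E_{31}$, $W_i=E_{2i}+E_{4i}+E_{i2}-E_{i4}$, $V_i=E_{1i}+E_{3i}+E_{i1}-E_{i3}$ for $5\le i\le n+2$, and let $M,L$ be the matrices with upper-left $4\times4$ blocks $$M:\begin{pmatrix}0&1&0&-1\\-1&0&1&0\\0&1&0&-1\\-1&0&1&0\end{pmatrix},\qquad L:\begin{pmatrix}0&1&0&-1\\-1&0&-1&0\\0&-1&0&1\\-1&0&-1&0\end{pmatrix}$$ and zeros elsewhere. Then $A=\exp(\mathrm{span}\{J_1,J_2\})$,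 $N=\exp(\mathrm{span}\{V_i,W_i,M,L\})$, and $\overline{N}=\theta(N)$, where $\theta$ is the Cartan involution, $\theta(X)=-X^T$ on the Lie algebra. Light cones: let $K_H\cong SO(n)$ be the subgroup of matrices $\mathrm{diag}(1,1,k)$, $k\in SO(n)$, and let $E=E_{12}-E_{21}+E_{14}+E_{41}$ (a nilpotent element of the Lie algebra). The future light ray from $\pi(g)$ in direction $k\in K_H$ is $\{\pi(g e^{-s\,\mathrm{Ad}(k)E}) : s\in\mathbb{R}^+\}$, and the future light cone of $\pi(g)$ is the union of these rays over $k\in K_H$ (this does not depend on the representative $g$). A point $[g]\in AdS_l$ is interior if for every $k\in K_H$ the future light ray from $[g]$ in direction $k$ meets $\mathscr{S}$ at some finite parameter value $s\in\mathbb{R}^+$. The interior region is the set of interior points; the event horizon is its boundary. *)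

(* Defs.v *)
(* MathComp-Analysis: the reals are an arbitrary [R : realType]. *)
From HB Require Import structures.
From mathcomp Require Import all_boot all_order all_algebra.
From mathcomp Require Import all_classical all_reals all_analysis.

Set Implicit Arguments.
Unset Strict Implicit.
Unset Printing Implicit Defensive.

Import Order.TTheory GRing.Theory Num.Theory.
Import numFieldNormedType.Exports.

Local Open Scope classical_set_scope.
Local Open Scope ring_scope.

Definition mexp (R : realType) (m : nat) (X : 'M[R]_m.+1) : 'M[R]_m.+1 :=
  limn (series (fun k : nat => (k`!%:R : R)^-1 *: X ^+ k)).

Section AdS.
Variables (R : realType) (l : nat).

(* All matrices have size n + 2, which is l + 1 as soon as 1 <= l. *)
Local Notation n := l.-1.
Implicit Types (g k X : 'M[R]_n.+2) (p : 'cV[R]_n.+2) (B : set 'M[R]_n.+2).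

(* Coordinates of a column: 0 is u, 1 is t, and [rshift 2 i] is x_(i + 1). *)
Definition AdS : set 'cV[R]_n.+2 :=
  [set p : 'cV[R]_n.+2 | p 0 0 ^+ 2 + p 1 0 ^+ 2
           - \sum_(i < n) p (rshift 2 i) 0 ^+ 2 = 1].

Definition eta : 'M[R]_n.+2 := block_mx (1%:M : 'M[R]_2) 0 0 (- 1%:M : 'M[R]_n).

Definition SO2n : set 'M[R]_n.+2 :=
  [set g | g^T *m eta *m g = eta /\ \det g = 1].

Definition G : set 'M[R]_n.+2 := connected_component SO2n 1%:M.

Definition base_point : 'cV[R]_n.+2 := delta_mx 0 0.

Definition proj g : 'cV[R]_n.+2 := g *m base_point.

(* Elementary matrices with indices counted from 1. *)
Definition E (i j : nat) : 'M[R]_n.+2 := delta_mx (inord i.-1) (inord j.-1).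

(* The matrix with the given rows in its upper-left corner, and zeros
   elsewhere. *)
Definition corner_mx (rows : seq (seq R)) : 'M[R]_n.+2 :=
  \matrix_(i, j) nth 0 (nth [::] rows i) j.

Definition J1 : 'M[R]_n.+2 := E 2 4 + E 4 2.
Definition J2 : 'M[R]_n.+2 := E 1 3 + E 3 1.
Definition W (i : nat) : 'M[R]_n.+2 := E 2 i + E 4 i + E i 2 - E i 4.
Definition V (i : nat) : 'M[R]_n.+2 := E 1 i + E 3 i + E i 1 - E i 3.
Definition M : 'M[R]_n.+2 := corner_mx
  [:: [::  0; 1; 0; -1];
      [:: -1; 0; 1;  0];
      [::  0; 1; 0; -1];
      [:: -1; 0; 1;  0] ].
Definition L : 'M[R]_n.+2 := corner_mx
  [:: [::  0;  1;  0; -1];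
      [:: -1;  0; -1;  0];
      [::  0; -1;  0;  1];
      [:: -1;  0; -1;  0] ].

Definition lieA : {vspace 'M[R]_n.+2} := <<[:: J1; J2]>>%VS.
Definition lieN : {vspace 'M[R]_n.+2} :=
  <<[:: M; L] ++ [seq V i | i <- index_iota 5 n.+3]
              ++ [seq W i | i <- index_iota 5 n.+3]>>%VS.

Definition theta X : 'M[R]_n.+2 := - X^T.

Definition groupA : set 'M[R]_n.+2 := (@mexp R n.+1) @` [set X | X \in lieA].
Definition groupN : set 'M[R]_n.+2 := (@mexp R n.+1) @` [set X | X \in lieN].

(* The Cartan involution of the group satisfies
   theta (exp X) = exp (theta X). *)
Definition groupNbar : set 'M[R]_n.+2 :=
  (@mexp R n.+1) @` (theta @` [set X | X \in lieN]).

Definition setM B1 B2 : set 'M[R]_n.+2 :=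
  [set g1 *m g2 | g1 in B1 & g2 in B2].

Definition orbit B p : set 'cV[R]_n.+2 := [set b *m p | b in B].

(* "Closed" refers to the topology of AdS, not to that of the ambient space. *)
Definition closed_orbits B : set (set 'cV[R]_n.+2) :=
  [set O | (exists2 p, AdS p & O = orbit B p)
           /\ closed (O : set (subspace AdS))].

Definition singularity : set 'cV[R]_n.+2 :=
  \bigcup_(O in closed_orbits (setM groupA groupN)
              `|` closed_orbits (setM groupA groupNbar)) O.

Definition K_H : set 'M[R]_n.+2 :=
  [set block_mx (1%:M : 'M[R]_2) 0 0 k
     | k in [set k : 'M[R]_n | k^T *m k = 1%:M /\ \det k = 1]].

Definition lightE : 'M[R]_n.+2 := E 1 2 - E 2 1 + E 1 4 + E 4 1.

Definition Ad g X : 'M[R]_n.+2 := g *m X *m invmx g.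

(* Strictly positive parameters: with s = 0 allowed, every point of the
   singularity would be interior. *)
Definition future_ray g k : set 'cV[R]_n.+2 :=
  [set proj (g *m mexp (- s *: Ad k lightE)) | s in [set s : R | 0 < s]].

(* The condition on g depends only on [proj g]: another representative
   permutes the rays and rescales their parameters positively. *)
Definition interior_region : set 'cV[R]_n.+2 :=
  [set proj g | g in [set g | G g /\
     forall k, K_H k -> future_ray g k `&` singularity !=set0]].

Definition event_horizon : set 'cV[R]_n.+2 :=
  closure (interior_region : set (subspace AdS))
    `\` interior (interior_region : set (subspace AdS)).

End AdS.

Arguments event_horizon R l : clear implicits.

(* Main.v *)
From mathcomp Require Import all_boot all_order all_algebra.
From mathcomp Require Import all_classical all_reals all_analysis.
From mathcomp Require Import ring lra zify.
Require Import Defs.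

Set Implicit Arguments.
Unset Strict Implicit.
Unset Printing Implicit Defensive.

Import Order.TTheory GRing.Theory Num.Theory.
Import numFieldNormedType.Exports.

Local Open Scope classical_set_scope.
Local Open Scope ring_scope.

(** The isometry group only enters through a few linear functionals.  Write
    x = x_1 and y = x_2.  In the light-cone coordinates t - y, t + y, u - x,
    u + x, the quadric AdS is
    (t - y)(t + y) + (u - x)(u + x) - (x_3^2 + x_4^2 + ...) = 1.
    Every generator of N kills the functional t - y, and A rescales it by a
    positive factor, so the sign of t - y is constant on each AN-orbit.

    If t - y = 0 on an orbit, then (u - x)(u + x) >= 1 there, and AN acts
    transitively on each of the two pieces u - x > 0 and u - x < 0 of the
    hyperplane section; these are the orbits of o and -o, and they are closed
    ([orbit_AN_base], [closed_orbit_AN_base]).  If t - y <> 0, an element of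
    exp (span M L) first brings t + y to 0, and then the boosts exp (s J1) let
    t - y tend to 0 inside the orbit: the limit lies in AdS but not in the
    orbit, which is not closed ([orbit_AN_not_closed]).  Conjugation by eta
    turns N into its opposite and exchanges t - y with t + y.  Hence the
    singularity is the set t^2 = y^2 in AdS ([lightcone_singularity],
    [singularity_lightcone]).

    The direction E being nilpotent, light rays are straight lines:
    g exp (- s Ad(K) E) o = g (o + s K (e_t - e_y)) ([ray_point]).  Along the
    circle (u, t) = (cos a, sin a) the ray in a direction with y-component v
    is t = sin a + s cos a, y = - s v.  For pi / 2 < a < pi it
    meets t = y or t = - y at the positive time sin a / (|v| - cos a), whatever
    the direction, so these points are interior ([interior_rotation]).  At
    a = pi / 2, that is at the point e_t, some direction moves along
    u = x with t = 1 and y = 0 forever and misses the singularity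
    ([t_axis_not_interior]).  So e_t is a limit of interior points which is not
    interior: it lies on the event horizon. *)

(** * The matrix exponential *)

(** All facts about [mexp] are obtained by testing it between a row and a
    column, where it becomes a scalar series. *)
Lemma cvg_pairing (R : realType) (a b : nat) (T : Type) (F : set_system T)
    {FF : Filter F} (f : 'rV[R]_a) (p : 'cV[R]_b)
    (u : T -> 'M[R]_(a, b)) (Y : 'M[R]_(a, b)) :
  u @ F --> Y -> (f *m u x *m p) 0 0 @[x --> F] --> (f *m Y *m p) 0 0.
Proof.
move=> uY.
have pairE Z : (f *m Z *m p) 0 0 = \sum_j (\sum_i f 0 i * Z i j) * p j 0.
  by rewrite mxE; apply: eq_bigr => j _; rewrite mxE.
rewrite pairE; under eq_fun do rewrite pairE.
apply: cvg_big => [|j _]; first exact: add_continuous.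
apply: cvgM; last exact: cvg_cst.
apply: cvg_big => [|i _]; first exact: add_continuous.
apply: cvgM; first exact: cvg_cst.
exact: (continuous_cvg _ (@coord_continuous _ _ _ i j Y) uY).
Qed.

Arguments cvg_pairing {R a b T F FF} f p {u Y}.

Section MatrixExponential.
Variables (R : realType) (m : nat).
Implicit Types (X Y : 'M[R]_m.+1) (f : 'rV[R]_m.+1) (p : 'cV[R]_m.+1).

(** The norm on matrices is the largest absolute value of an entry, which is
    submultiplicative only up to the size of the matrix. *)
Lemma mx_norm_mulmx X Y : `|X *m Y| <= m.+1%:R * (`|X| * `|Y|).
Proof.
have bnd (Z : 'M[R]_m.+1) i j : `|Z i j| <= `|Z|.
  rewrite [X in _ <= X]/Num.norm /= mx_normrE.
  exact: (le_bigmax _ (fun ij => `|Z ij.1 ij.2|) (i, j)).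
rewrite [leLHS]/Num.norm /= mx_normrE; apply: bigmax_le => [|[i j] _] /=.
  by rewrite !mulr_ge0.
rewrite mxE (le_trans (ler_norm_sum _ _ _))//.
rewrite (@le_trans _ _ (\sum_(k < m.+1) `|X| * `|Y|))//.
  by apply: ler_sum => k _; rewrite normrM ler_pM.
by rewrite sumr_const card_ord mulr_natl.
Qed.

Lemma mx_norm_expr X k :
  `|X ^+ k| <= `|(1 : 'M[R]_m.+1)| * (m.+1%:R * `|X|) ^+ k.
Proof.
elim: k => [|k IH]; first by rewrite !expr0 mulr1.
rewrite exprS (le_trans (mx_norm_mulmx _ _))// exprS.
by rewrite [leRHS]mulrCA mulrA ler_wpM2l// mulr_ge0.
Qed.

(** The series converges normally, by comparison with that of
    exp (m.+1 * |X|). *)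
Lemma is_cvg_mexp X :
  cvgn (series (fun k : nat => (k`!%:R : R)^-1 *: X ^+ k)).
Proof.
set u := fun k : nat => _.
pose c := m.+1%:R * `|X|.
have : cvgn [normed series u].
  apply: (@series_le_cvg _ _ (`|(1 : 'M[R]_m.+1)| *: exp_coeff c)).
  - by move=> k /=.
  - by move=> k; rewrite /= mulr_ge0// exp_coeff_ge0// mulr_ge0.
  - move=> k /=; rewrite normrZ ger0_norm ?invr_ge0//.
    rewrite [leRHS](_ : _ = k`!%:R^-1 * (`|(1 : 'M[R]_m.+1)| * c ^+ k)).
      by rewrite ler_wpM2l ?invr_ge0// mx_norm_expr.
    rewrite (_ : _ (exp_coeff c) k = `|(1 : 'M[R]_m.+1)| * (c ^+ k / k`!%:R))//.
    by rewrite mulrA mulrC.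
  - exact/is_cvg_seriesZ/is_cvg_series_exp_coeff.
move=> /cauchy_cvgP/cauchy_seriesP u_ncvg.
apply: cauchy_cvg; apply/cauchy_seriesP => e /u_ncvg.
apply: filterS => k /=; rewrite ger0_norm ?sumr_ge0//.
by apply: le_lt_trans; apply: ler_norm_sum.
Qed.

Lemma mexp_pairing X f p :
  series (fun k : nat => (k`!%:R : R)^-1 * (f *m X ^+ k *m p) 0 0) @ \oo
    --> (f *m mexp X *m p) 0 0.
Proof.
rewrite (_ : series _ = fun N =>
    (f *m series (fun k : nat => (k`!%:R : R)^-1 *: X ^+ k) N *m p) 0 0).
  exact: (cvg_pairing f p (@is_cvg_mexp X)).
apply/funext => N; rewrite /series /= mulmx_sumr mulmx_suml summxE.
by apply: eq_bigr => k _; rewrite -scalemxAr -scalemxAl [RHS]mxE.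
Qed.

Lemma mexp_pairing_unique X f p (a : R) :
  series (fun k : nat => (k`!%:R : R)^-1 * (f *m X ^+ k *m p) 0 0) @ \oo
    --> a ->
  (f *m mexp X *m p) 0 0 = a.
Proof. by move=> h; exact: (cvg_unique _ (@mexp_pairing X f p) h). Qed.

Lemma mexp_eigen X f mu : f *m X = mu *: f -> f *m mexp X = expR mu *: f.
Proof.
move=> fX; have fXk k : f *m X ^+ k = mu ^+ k *: f.
  elim: k => [|k IH]; first by rewrite expr0 mulmx1 expr0 scale1r.
  by rewrite exprSr mulmxA IH -scalemxAl fX scalerA -exprSr.
apply/rowP => j; rewrite [RHS]mxE.
have -> : (f *m mexp X) 0 j = (f *m mexp X *m (delta_mx j 0 : 'cV_m.+1)) 0 0.
  by rewrite -colE [RHS]mxE.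
apply: mexp_pairing_unique.
rewrite (_ : series _ = fun N => series (exp_coeff mu) N * f 0 j).
  by apply: cvgM; [exact: is_cvg_series_exp_coeff|exact: cvg_cst].
apply/funext => N; rewrite /series /= mulr_suml.
apply: eq_bigr => k _; rewrite fXk -colE !mxE mulrA; congr (_ * _).
by rewrite mulrC.
Qed.

(** Only the pairings with f and p have to vanish, so X itself may fail to be
    nilpotent; below, powers of X kill either the row or the column. *)
Lemma mexp_nilpotent X f p :
  (forall k, (f *m X ^+ k.+3 *m p) 0 0 = 0) ->
  (f *m mexp X *m p) 0 0 =
  (f *m p) 0 0 + (f *m X *m p) 0 0 + 2^-1 * (f *m X *m X *m p) 0 0.
Proof.
move=> h; apply: mexp_pairing_unique; apply: cvg_near_cst.
exists 3%N => // -[|[|[|N]]] //= _.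
rewrite /series/= !big_nat_recl// big1 => [|i _]; last by rewrite h mulr0.
rewrite !factS fact0 expr0 expr1 mulmx1 invr1 !mul1r addr0 expr2 mulmxA addrA.
by rewrite muln1.
Qed.

Lemma mexp_nilpotent_row X f : f *m X *m X *m X = 0 ->
  f *m mexp X = f + f *m X + 2^-1 *: (f *m X *m X).
Proof.
move=> fX3; apply/rowP => j.
have entry (g : 'rV[R]_m.+1) : g 0 j = (g *m (delta_mx j 0 : 'cV_m.+1)) 0 0.
  by rewrite -colE [RHS]mxE.
rewrite entry mexp_nilpotent -?entry; first by rewrite !mxE.
move=> k; rewrite -entry 3!exprS -!mulmxE !mulmxA fX3.
by rewrite mul0mx mxE.
Qed.

Lemma mexp_nilpotent_col X p : X *m (X *m p) = 0 ->
  mexp X *m p = p + X *m p.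
Proof.
move=> Xp2; apply/colP => i.
have entry (q : 'cV[R]_m.+1) : q i 0 = ((delta_mx 0 i : 'rV_m.+1) *m q) 0 0.
  by rewrite -rowE [RHS]mxE.
rewrite entry mulmxA mexp_nilpotent.
  rewrite -!mulmxA Xp2 mulmx0 [X in _ + _ + _ * X]mxE mulr0 addr0.
  by rewrite -!entry [RHS]mxE.
move=> k; rewrite !exprSr -!mulmxE -!mulmxA Xp2 !mulmx0.
by rewrite mxE.
Qed.

Lemma mexp_conj X Y : Y *m Y = 1%:M -> mexp (Y *m X *m Y) = Y *m mexp X *m Y.
Proof.
move=> YY; apply/matrixP => i j.
pose f := delta_mx 0 i : 'rV[R]_m.+1; pose p := delta_mx j 0 : 'cV[R]_m.+1.
have entry (Z : 'M[R]_m.+1) : Z i j = (f *m Z *m p) 0 0.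
  by rewrite -rowE -colE !mxE.
rewrite !entry; apply: mexp_pairing_unique; rewrite !mulmxA.
rewrite (_ : series _ = series (fun k : nat =>
    (k`!%:R : R)^-1 * (f *m Y *m X ^+ k *m (Y *m p)) 0 0)).
  by rewrite -(mulmxA _ Y p); exact: mexp_pairing.
apply/funext => N; rewrite /series /=; apply: eq_bigr => k _; congr (_ * _).
have -> : (Y *m X *m Y) ^+ k = Y *m X ^+ k *m Y.
  elim: (k : nat) => [|k' IH]; first by rewrite !expr0 mulmx1.
  by rewrite exprS IH exprS -!mulmxE !mulmxA -(mulmxA _ Y Y) YY mulmx1.
by rewrite !mulmxA.
Qed.

End MatrixExponential.

(** * Spans, linear maps and orthogonal matrices *)

Lemma span_ind (K : fieldType) (vT : vectType K) (P : vT -> Prop) (s : seq vT) :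
  P 0 -> (forall a u v, P u -> P v -> P (a *: u + v)) ->
  (forall v, v \in s -> P v) -> forall v, v \in span s -> P v.
Proof.
move=> P0 PD Ps v /(@coord_span _ _ _ (in_tuple s)) ->.
elim/big_rec: _ => // i u _ Pu; apply: PD => //.
by apply: Ps; rewrite mem_nth.
Qed.

Lemma cvg_mulmx (R : realType) (m n : nat) (T : Type) (F : set_system T)
    {FF : Filter F} (A : 'M[R]_(m, n)) (u : T -> 'cV[R]_n) (p : 'cV[R]_n) :
  u @ F --> p -> A *m u x @[x --> F] --> A *m p.
Proof.
move=> up.
have AE q : A *m q = \sum_i ((delta_mx 0 i : 'rV_m) *m A *m q *m
    (1%:M : 'cV[R]_1)) 0 0 *: (delta_mx i 0 : 'cV[R]_m).
  rewrite [LHS]matrix_sum_delta; apply: eq_bigr => i _.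
  by rewrite big_ord1 mulmx1 -mulmxA -rowE [in RHS]mxE.
rewrite AE; under eq_fun do rewrite AE.
apply: cvg_big => [|i _]; first exact: add_continuous.
apply: cvgZ; last exact: cvg_cst.
exact: cvg_pairing.
Qed.

Lemma continuous_mulmx (R : realType) (m n : nat) (A : 'M[R]_(m, n)) :
  continuous (fun p : 'cV[R]_n => A *m p).
Proof.
by move=> p; apply: (@cvg_mulmx R m n _ (nbhs p) _ A id p); exact: cvg_id.
Qed.

Lemma sum_sqr_dot (R : realFieldType) (n : nat) (d : 'cV[R]_n) :
  (d^T *m d) 0 0 = \sum_i d i 0 ^+ 2.
Proof. by rewrite mxE; apply: eq_bigr => i _; rewrite mxE expr2. Qed.

Lemma dot_eq0 (R : realFieldType) (n : nat) (d : 'cV[R]_n) :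
  (d^T *m d) 0 0 = 0 -> d = 0.
Proof.
rewrite sum_sqr_dot => /eqP.
rewrite psumr_eq0; last by move=> i _; exact: sqr_ge0.
move=> /allP d0; apply/colP => i; rewrite mxE.
by have := d0 i (mem_index_enum i); rewrite /= sqrf_eq0 => /eqP.
Qed.

(** The Householder reflection along u - e exchanges e and u. *)
Lemma orthogonal_transitive (R : realFieldType) (n : nat) (e u : 'cV[R]_n) :
  e^T *m e = 1%:M -> u^T *m u = 1%:M ->
  exists Om : 'M[R]_n, Om^T *m Om = 1%:M /\ Om *m e = u.
Proof.
move=> ee uu; have [->|neq] := eqVneq u e.
  by exists 1%:M; rewrite trmx1 !mul1mx.
pose d := u - e; pose N := (d^T *m d) 0 0.
have N0 : N != 0.
  by apply: contra_neq neq => /dot_eq0 /eqP; rewrite subr_eq0 => /eqP.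
have dd : d^T *m d = N%:M by rewrite [LHS]mx11_scalar.
have dT : d^T = u^T - e^T by rewrite /d linearB.
pose H : 'M[R]_n := 1%:M - (2 / N) *: (d *m d^T).
have HT : H^T = H.
  by rewrite /H linearB linearZ /= trmx1 trmx_mul trmxK.
have ddd : d *m d^T *m (d *m d^T) = N *: (d *m d^T).
  by rewrite mulmxA -(mulmxA d) dd mul_mx_scalar scalemxAl.
exists H; split.
  rewrite HT /H mulmxBl mul1mx mulmxBr mulmx1 -scalemxAl -scalemxAr ddd.
  rewrite !scalerA.
  move: (d *m d^T) => A; apply/matrixP => i j; rewrite !mxE.
  by field.
pose c := (u^T *m e) 0 0.
have de : d^T *m e = (c - 1)%:M.
  by rewrite dT mulmxBl ee [u^T *m e]mx11_scalar -/c -raddfB.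
have Nc : N = 2 - 2 * c.
  have eu : e^T *m u = c%:M.
    by rewrite -[LHS]trmxK trmx_mul trmxK [u^T *m e]mx11_scalar tr_scalar_mx.
  rewrite /N dT /d mulmxBl !mulmxBr ee uu eu [u^T *m e]mx11_scalar -/c.
  by rewrite !mxE /=; ring.
rewrite /H mulmxBl mul1mx -scalemxAl -mulmxA de mul_mx_scalar scalerA.
rewrite (_ : 2 / N * (c - 1) = -1); last by rewrite Nc in N0 *; field.
by rewrite scaleN1r opprK /d addrC subrK.
Qed.

(** If an orthogonal matrix carrying e_1 to u has determinant -1, it is
    corrected by the reflection along e_0, which fixes e_1; this is where
    dimension at least 2 enters. *)
Lemma SO_transitive (R : realFieldType) (n : nat) (u : 'cV[R]_n.+2) :
  u^T *m u = 1%:M -> exists Om : 'M[R]_n.+2,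
    [/\ Om^T *m Om = 1%:M, \det Om = 1 & Om *m delta_mx 1 0 = u].
Proof.
move=> uu; pose e : 'cV[R]_n.+2 := delta_mx 1 0.
have ee : e^T *m e = 1%:M.
  by rewrite /e trmx_delta mul_delta_mx [LHS]mx11_scalar mxE eqxx.
have [Om [OO Oe]] := orthogonal_transitive ee uu.
have : \det Om ^+ 2 = 1.
  by rewrite expr2 -{1}det_tr -det_mulmx OO det1.
move=> /eqP; rewrite sqrf_eq1 => /orP[/eqP dO|/eqP dO]; first by exists Om.
pose r : 'rV[R]_n.+2 := \row_i (if i == 0 then -1 else 1).
exists (Om *m diag_mx r); split.
- rewrite trmx_mul tr_diag_mx mulmxA -(mulmxA _ Om^T) OO mulmx1 mulmx_diag.
  rewrite -diag_const_mx; congr diag_mx; apply/rowP => i.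
  by rewrite !mxE; case: ifP => _; ring.
- rewrite det_mulmx dO det_diag big_ord_recl mxE /= big1.
    by rewrite mulr1 mulrNN mulr1.
  by move=> i _; rewrite mxE.
- rewrite -mulmxA -Oe; congr (_ *m _); apply/colP => i.
  by rewrite mul_diag_mx !mxE; case: ifP => [/eqP ->|_]; rewrite ?mulr0 ?mul1r.
Qed.

Section AntiDeSitter.
Variables (R : realType) (k : nat).
Local Notation l := k.+3.
Implicit Types (X g K : 'M[R]_k.+4) (p q v : 'cV[R]_k.+4) (f h : 'rV[R]_k.+4).
Local Notation o := (base_point R l).
Local Notation eta := (Defs.eta R l : 'M[R]_k.+4).
Local Notation e_ i := (delta_mx (inord i) 0 : 'cV[R]_k.+4).

(** * Light-cone coordinates *)

(** Linear functionals are rows: [covec a] is the coordinate of index a in the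
    order (u, t, x, y, x_3, x_4, ...), so [covec i.+4] is x_(i+3). *)
Definition covec (a : nat) : 'rV[R]_k.+4 := delta_mx 0 (inord a).

Definition ev f p : R := (f *m p) 0 0.

Lemma evD f h p : ev (f + h) p = ev f p + ev h p.
Proof. by rewrite /ev mulmxDl mxE. Qed.
Lemma evN f p : ev (- f) p = - ev f p.
Proof. by rewrite /ev mulNmx mxE. Qed.
Lemma evZ a f p : ev (a *: f) p = a * ev f p.
Proof. by rewrite /ev -scalemxAl mxE. Qed.
Lemma ev_sum I (r : seq I) (F : I -> 'rV[R]_k.+4) p :
  ev (\sum_(i <- r) F i) p = \sum_(i <- r) ev (F i) p.
Proof. by rewrite /ev mulmx_suml summxE. Qed.
Lemma ev_mulmx f X p : ev f (X *m p) = ev (f *m X) p.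
Proof. by rewrite /ev mulmxA. Qed.
Lemma ev_colD f p q : ev f (p + q) = ev f p + ev f q.
Proof. by rewrite /ev mulmxDr mxE. Qed.
Lemma ev_colZ f a p : ev f (a *: p) = a * ev f p.
Proof. by rewrite /ev -scalemxAr mxE. Qed.

Lemma ev_colN f p : ev f (- p) = - ev f p.
Proof. by rewrite /ev mulmxN mxE. Qed.

Lemma ev_covec a p : ev (covec a) p = p (inord a) 0.
Proof. by rewrite /ev -rowE mxE. Qed.

Lemma inord_eq a b : (a < k.+4)%N -> (b < k.+4)%N ->
  (inord a == inord b :> 'I_k.+4) = (a == b).
Proof. by move=> ha hb; rewrite -val_eqE /= !inordK. Qed.

Lemma ev_covec_delta a b : (a < k.+4)%N -> (b < k.+4)%N ->
  ev (covec a) (delta_mx (inord b) 0) = (a == b)%:R.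
Proof. by move=> ha hb; rewrite ev_covec mxE inord_eq// eqxx andbT. Qed.

Lemma covec_E a i j : (a < k.+4)%N -> (i < k.+4)%N ->
  covec a *m E R l i.+1 j.+1 = covec j *+ (a == i).
Proof. by move=> ha hi; rewrite /covec /E mul_delta_mx_cond inord_eq. Qed.

Lemma covec_corner (rows : seq (seq R)) a : (a < k.+4)%N ->
  (size (nth [::] rows a) <= 4)%N ->
  covec a *m corner_mx l rows =
  let c := nth 0 (nth [::] rows a) in
  c 0%N *: covec 0 + c 1%N *: covec 1 + c 2%N *: covec 2 + c 3%N *: covec 3.
Proof.
move=> ha; set r := nth [::] rows a => hr.
apply/rowP => j; rewrite -rowE !mxE /= inordK// -/r.
have -> : j = inord (val j) :> 'I_k.+4 by rewrite inord_val.
have hj : (val j < k.+4)%N := ltn_ord j.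
move: (val j) hj => b hb; rewrite inordK// !inord_eq//.
case: b hb => [|[|[|[|b]]]] hb /=; rewrite ?mulr0 ?mulr1 ?addr0 ?add0r//.
by rewrite nth_default// (leq_trans hr).
Qed.

(** The four null coordinates.  They are locked so that the additivity of [ev]
    does not split them.  Throughout the proofs, T, T', D and S in the names of
    hypotheses refer to t - y, t + y, u - x and u + x. *)
Definition t_minus_y := locked (covec 1 - covec 3).
Definition t_plus_y := locked (covec 1 + covec 3).
Definition u_minus_x := locked (covec 0 - covec 2).
Definition u_plus_x := locked (covec 0 + covec 2).

Lemma t_minus_yE : t_minus_y = covec 1 - covec 3.
Proof. by rewrite /t_minus_y -lock. Qed.
Lemma t_plus_yE : t_plus_y = covec 1 + covec 3.
Proof. by rewrite /t_plus_y -lock. Qed.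
Lemma u_minus_xE : u_minus_x = covec 0 - covec 2.
Proof. by rewrite /u_minus_x -lock. Qed.
Lemma u_plus_xE : u_plus_x = covec 0 + covec 2.
Proof. by rewrite /u_plus_x -lock. Qed.

Lemma lightcone_entries p :
  [/\ ev t_minus_y p = p (inord 1) 0 - p (inord 3) 0,
  ev t_plus_y p = p (inord 1) 0 + p (inord 3) 0,
  ev u_minus_x p = p (inord 0) 0 - p (inord 2) 0 &
  ev u_plus_x p = p (inord 0) 0 + p (inord 2) 0].
Proof.
by rewrite t_minus_yE t_plus_yE u_minus_xE u_plus_xE !(evD, evN) !ev_covec.
Qed.

Ltac corner := rewrite covec_corner//=
  ?scale0r ?scale1r ?scaleN1r ?add0r ?addr0 //.

Lemma covec_M : [/\ covec 0 *m M R l = t_minus_y,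
  covec 1 *m M R l = - u_minus_x,
  covec 2 *m M R l = t_minus_y & covec 3 *m M R l = - u_minus_x].
Proof. by split; corner; rewrite ?t_minus_yE ?u_minus_xE ?opprB // addrC. Qed.

Lemma covec_L : [/\ covec 0 *m L R l = t_minus_y,
  covec 1 *m L R l = - u_plus_x,
  covec 2 *m L R l = - t_minus_y & covec 3 *m L R l = - u_plus_x].
Proof.
by split; corner; rewrite ?t_minus_yE ?u_plus_xE ?opprB ?opprD // addrC.
Qed.

Lemma covec_W a i : (a < k.+4)%N -> (i < k)%N ->
  covec a *m W R l i.+4.+1 = covec i.+4 *+ (a == 1)%N + covec i.+4 *+ (a == 3)%N
    + t_minus_y *+ (a == i.+4).
Proof.
move=> ha hi; rewrite /W mulmxBr !mulmxDr !covec_E// -addrA -mulrnBl.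
by rewrite t_minus_yE.
Qed.

Lemma covec_V a i : (a < k.+4)%N -> (i < k)%N ->
  covec a *m V R l i.+4.+1 = covec i.+4 *+ (a == 0)%N + covec i.+4 *+ (a == 2)%N
    + u_minus_x *+ (a == i.+4).
Proof.
move=> ha hi; rewrite /V mulmxBr !mulmxDr !covec_E// -addrA -mulrnBl.
by rewrite u_minus_xE.
Qed.

Lemma covec_J1 a : (a < k.+4)%N ->
  covec a *m J1 R l = covec 3 *+ (a == 1)%N + covec 1 *+ (a == 3)%N.
Proof. by move=> ha; rewrite /J1 mulmxDr !covec_E. Qed.

Lemma covec_J2 a : (a < k.+4)%N ->
  covec a *m J2 R l = covec 2 *+ (a == 0)%N + covec 0 *+ (a == 2)%N.
Proof. by move=> ha; rewrite /J2 mulmxDr !covec_E. Qed.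

Lemma covec4_M i : (i < k)%N -> covec i.+4 *m M R l = 0.
Proof. by move=> hi; corner; rewrite !nth_nil ?scale0r ?addr0. Qed.

Lemma covec4_L i : (i < k)%N -> covec i.+4 *m L R l = 0.
Proof. by move=> hi; corner; rewrite !nth_nil ?scale0r ?addr0. Qed.

(** The next lemmas give the action of the generators on the light-cone
    functionals: those of A are diagonal, and those of N are strictly
    triangular for the order T, D, x_i, S, T'. *)
Lemma lightcone_J1 : [/\ t_minus_y *m J1 R l = - t_minus_y,
  t_plus_y *m J1 R l = t_plus_y, u_minus_x *m J1 R l = 0,
  u_plus_x *m J1 R l = 0 & forall i, (i < k)%N -> covec i.+4 *m J1 R l = 0].
Proof.
split; last by move=> i hi; rewrite covec_J1// addr0.
all: rewrite ?t_minus_yE ?t_plus_yE ?u_minus_xE ?u_plus_xE.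
all: rewrite ?mulmxBl ?mulmxDl !covec_J1//=.
all: rewrite ?mulr0n ?mulr1n ?addr0 ?add0r ?subrr ?oppr0 ?addr0 ?opprB //.
all: by rewrite addrC.
Qed.

Lemma lightcone_J2 : [/\ t_minus_y *m J2 R l = 0,
  t_plus_y *m J2 R l = 0, u_minus_x *m J2 R l = - u_minus_x,
  u_plus_x *m J2 R l = u_plus_x &
  forall i, (i < k)%N -> covec i.+4 *m J2 R l = 0].
Proof.
split; last by move=> i hi; rewrite covec_J2// addr0.
all: rewrite ?t_minus_yE ?t_plus_yE ?u_minus_xE ?u_plus_xE.
all: rewrite ?mulmxBl ?mulmxDl !covec_J2//=.
all: rewrite ?mulr0n ?mulr1n ?addr0 ?add0r ?subrr ?oppr0 ?addr0 ?opprB //.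
all: by rewrite addrC.
Qed.

Lemma lightcone_M : [/\ t_minus_y *m M R l = 0,
  t_plus_y *m M R l = - (2 *: u_minus_x), u_minus_x *m M R l = 0,
  u_plus_x *m M R l = 2 *: t_minus_y &
  forall i, (i < k)%N -> covec i.+4 *m M R l = 0].
Proof.
have [h0 h1 h2 h3] := covec_M; split; last exact: covec4_M.
- by rewrite t_minus_yE mulmxBl h1 h3 subrr.
- by rewrite t_plus_yE mulmxDl h1 h3 -opprD scaler_nat mulr2n.
- by rewrite u_minus_xE mulmxBl h0 h2 subrr.
- by rewrite u_plus_xE mulmxDl h0 h2 scaler_nat mulr2n.
Qed.

Lemma lightcone_L : [/\ t_minus_y *m L R l = 0,
  t_plus_y *m L R l = - (2 *: u_plus_x),
  u_minus_x *m L R l = 2 *: t_minus_y, u_plus_x *m L R l = 0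
  & forall i, (i < k)%N -> covec i.+4 *m L R l = 0].
Proof.
have [h0 h1 h2 h3] := covec_L; split; last exact: covec4_L.
- by rewrite t_minus_yE mulmxBl h1 h3 subrr.
- by rewrite t_plus_yE mulmxDl h1 h3 -opprD scaler_nat mulr2n.
- by rewrite u_minus_xE mulmxBl h0 h2 opprK scaler_nat mulr2n.
- by rewrite u_plus_xE mulmxDl h0 h2 subrr.
Qed.

Lemma lightcone_W j : (j < k)%N ->
  [/\ t_minus_y *m W R l j.+4.+1 = 0,
  t_plus_y *m W R l j.+4.+1 = 2 *: covec j.+4,
  u_minus_x *m W R l j.+4.+1 = 0, u_plus_x *m W R l j.+4.+1 = 0
  & forall i, (i < k)%N -> covec i.+4 *m W R l j.+4.+1 = t_minus_y *+ (i == j)].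
Proof.
move=> hj; split; last by move=> i hi; rewrite covec_W//= !add0r.
all: rewrite ?t_plus_yE ?u_minus_xE ?u_plus_xE ?[X in X *m _]t_minus_yE.
all: rewrite ?mulmxBl ?mulmxDl !covec_W//=.
all: rewrite ?mulr0n ?mulr1n ?addr0 ?add0r ?subrr ?oppr0 //.
all: by rewrite scaler_nat mulr2n.
Qed.

Lemma lightcone_V j : (j < k)%N ->
  [/\ t_minus_y *m V R l j.+4.+1 = 0, t_plus_y *m V R l j.+4.+1 = 0,
  u_minus_x *m V R l j.+4.+1 = 0, u_plus_x *m V R l j.+4.+1 = 2 *: covec j.+4
  & forall i, (i < k)%N -> covec i.+4 *m V R l j.+4.+1 = u_minus_x *+ (i == j)].
Proof.
move=> hj; split; last by move=> i hi; rewrite covec_V//= !add0r.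
all: rewrite ?t_plus_yE ?t_minus_yE ?u_plus_xE ?[X in X *m _]u_minus_xE.
all: rewrite ?mulmxBl ?mulmxDl !covec_V//=.
all: rewrite ?mulr0n ?mulr1n ?addr0 ?add0r ?subrr ?oppr0 //.
all: by rewrite scaler_nat mulr2n.
Qed.

Lemma lieN_ind (P : 'M[R]_k.+4 -> Prop) :
  P 0 -> (forall a X Y, P X -> P Y -> P (a *: X + Y)) ->
  P (M R l) -> P (L R l) -> (forall i, (i < k)%N -> P (V R l i.+4.+1)) ->
  (forall i, (i < k)%N -> P (W R l i.+4.+1)) -> forall X, X \in lieN R l -> P X.
Proof.
move=> P0 PD PM PL PV PW; apply: span_ind => // X.
have idx i : i \in index_iota 5 l.-1.+3 -> exists2 j, (j < k)%N & i = j.+4.+1.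
  rewrite mem_index_iota /= => /andP[h5 hi].
  by exists (i - 5)%N; lia.
rewrite !mem_cat !inE => /orP[/orP[/eqP ->|/eqP ->]|/orP[]]//.
  by move=> /mapP[i /idx[j hj ->] ->]; exact: PV.
by move=> /mapP[i /idx[j hj ->] ->]; exact: PW.
Qed.

Lemma lieA_ind (P : 'M[R]_k.+4 -> Prop) :
  P 0 -> (forall a X Y, P X -> P Y -> P (a *: X + Y)) ->
  P (J1 R l) -> P (J2 R l) -> forall X, X \in lieA R l -> P X.
Proof.
move=> P0 PD P1 P2; apply: span_ind => // X.
by rewrite !inE => /orP[/eqP ->|/eqP ->].
Qed.

Lemma lieN_lightcone X : X \in lieN R l ->
  t_minus_y *m X = 0 /\ exists c, u_minus_x *m X = c *: t_minus_y.
Proof.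
move: X; apply: lieN_ind => [|a X Y [TX [c DX]] [TY [d DY]]||| |].
- by rewrite !mulmx0; split => //; exists 0; rewrite scale0r.
- rewrite !mulmxDr -!scalemxAr TX TY DX DY scaler0 addr0; split => //.
  by exists (a * c + d); rewrite scalerDl scalerA.
- by have [-> _ -> _ _] := lightcone_M; split => //; exists 0; rewrite scale0r.
- by have [-> _ -> _ _] := lightcone_L; split => //; exists 2.
- by move=> i /lightcone_V[-> _ -> _ _]; split => //; exists 0; rewrite scale0r.
- by move=> i /lightcone_W[-> _ -> _ _]; split => //; exists 0; rewrite scale0r.
Qed.

Lemma lieA_lightcone X : X \in lieA R l ->
  exists a b, t_minus_y *m X = a *: t_minus_y /\
              u_minus_x *m X = b *: u_minus_x.
Proof.
move: X; apply: lieA_ind => [|c X Y [a [b [TX DX]]] [a' [b' [TY DY]]]||].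
- by exists 0, 0; rewrite !mulmx0 !scale0r.
- exists (c * a + a'), (c * b + b').
  by rewrite !mulmxDr -!scalemxAr TX TY DX DY !scalerDl !scalerA.
- have [-> _ -> _ _] := lightcone_J1; exists (-1), 0.
  by rewrite scaleN1r scale0r.
- have [-> _ -> _ _] := lightcone_J2; exists 0, (-1).
  by rewrite scaleN1r scale0r.
Qed.

Definition AN : set 'M[R]_k.+4 := setM (@groupA R l) (@groupN R l).

(** The signs of T, and of D where T vanishes, are constant on AN-orbits. *)
Lemma AN_lightcone b : AN b ->
  exists x y z, [/\ 0 < x, 0 < y, t_minus_y *m b = x *: t_minus_y &
                    u_minus_x *m b = y *: u_minus_x + z *: t_minus_y].
Proof.
move=> [_ [X /lieA_lightcone[s [t [TX DX]]] <-]].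
move=> [_ [Y /lieN_lightcone[TY [c DY]]] <-] <-.
exists (expR s), (expR t), (expR t * c); split; rewrite ?expR_gt0//.
  rewrite mulmxA (mexp_eigen TX) -scalemxAl; congr (_ *: _).
  by rewrite mexp_nilpotent_row ?TY ?mul0mx// scaler0 !addr0.
rewrite mulmxA (mexp_eigen DX) -scalemxAl -scalerA -scalerDr; congr (_ *: _).
have DYY : u_minus_x *m Y *m Y = 0 by rewrite DY -scalemxAl TY scaler0.
by rewrite mexp_nilpotent_row ?DYY ?mul0mx// scaler0 addr0 DY.
Qed.

Lemma ev_ext p q : ev t_minus_y p = ev t_minus_y q ->
  ev t_plus_y p = ev t_plus_y q ->
  ev u_minus_x p = ev u_minus_x q -> ev u_plus_x p = ev u_plus_x q ->
  (forall i, (i < k)%N -> ev (covec i.+4) p = ev (covec i.+4) q) -> p = q.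
Proof.
have [-> -> -> ->] := lightcone_entries p.
have [-> -> -> ->] := lightcone_entries q.
move=> e1 e2 e3 e4 ei; apply/colP => j.
have -> : j = inord (val j) :> 'I_k.+4 by rewrite inord_val.
have hj : (val j < k.+4)%N := ltn_ord j.
move: (val j) hj => b hb.
case: b hb => [|[|[|[|b]]]] hb; try lra.
by rewrite -!ev_covec ei.
Qed.

(** The Lorentz form u^2 + t^2 - x^2 - y^2 - ... in light-cone coordinates. *)
Definition qform p : R :=
  ev t_minus_y p * ev t_plus_y p + ev u_minus_x p * ev u_plus_x p
  - \sum_(i < k) ev (covec i.+4) p ^+ 2.

Lemma AdS_qform p : AdS (p : 'cV[R]_l.-1.+2) <-> qform p = 1.
Proof.
have -> : qform p = p 0 0 ^+ 2 + p 1 0 ^+ 2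
    - \sum_(i < k.+2) p (rshift 2 i : 'I_k.+4) 0 ^+ 2; last by [].
rewrite /qform; have [-> -> -> ->] := lightcone_entries p.
rewrite !big_ord_recl.
have -> : inord 0 = 0 :> 'I_k.+4 by apply/val_inj; rewrite /= inordK.
have -> : inord 1 = 1 :> 'I_k.+4 by apply/val_inj; rewrite /= inordK.
have -> : rshift 2 (ord0 : 'I_k.+2) = inord 2 :> 'I_k.+4.
  by apply/val_inj; rewrite /= inordK.
have -> : rshift 2 (lift ord0 (ord0 : 'I_k.+1)) = inord 3 :> 'I_k.+4.
  by apply/val_inj; rewrite /= inordK.
rewrite (eq_bigr (fun i : 'I_k =>
  p (rshift 2 (lift ord0 (lift ord0 i)) : 'I_k.+4) 0 ^+ 2)); first by ring.
move=> i _; rewrite ev_covec; congr (p _ 0 ^+ 2).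
by apply/val_inj; rewrite /= inordK// !ltnS.
Qed.

Lemma ev_mexp_eigen f X mu (s : R) p : f *m X = mu *: f ->
  ev f (mexp (s *: X) *m p) = expR (s * mu) * ev f p.
Proof.
move=> h; have sh : f *m (s *: X) = (s * mu) *: f.
  by rewrite -scalemxAr h scalerA.
by rewrite ev_mulmx (mexp_eigen sh) evZ.
Qed.

Lemma ev_mexp_kernel f X (s : R) p : f *m X = 0 ->
  ev f (mexp (s *: X) *m p) = ev f p.
Proof.
move=> fX; rewrite (@ev_mexp_eigen _ _ 0) ?mulr0 ?expR0 ?mul1r//.
by rewrite fX scale0r.
Qed.

Lemma mexp_J1 (s : R) p : let q := mexp (s *: J1 R l) *m p in
  [/\ ev t_minus_y q = expR (- s) * ev t_minus_y p,
  ev t_plus_y q = expR s * ev t_plus_y p,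
  ev u_minus_x q = ev u_minus_x p, ev u_plus_x q = ev u_plus_x p &
  forall i, (i < k)%N -> ev (covec i.+4) q = ev (covec i.+4) p].
Proof.
have [hT hT' hD hS hi] := lightcone_J1; split=> [||||i hik] /=.
- by rewrite (@ev_mexp_eigen _ _ (-1)) ?mulrN1// hT scaleN1r.
- by rewrite (@ev_mexp_eigen _ _ 1) ?mulr1// hT' scale1r.
- exact: ev_mexp_kernel.
- exact: ev_mexp_kernel.
- by apply: ev_mexp_kernel; exact: hi.
Qed.

Lemma mexp_J2 (s : R) p : let q := mexp (s *: J2 R l) *m p in
  [/\ ev t_minus_y q = ev t_minus_y p, ev t_plus_y q = ev t_plus_y p,
  ev u_minus_x q = expR (- s) * ev u_minus_x p,
  ev u_plus_x q = expR s * ev u_plus_x p &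
  forall i, (i < k)%N -> ev (covec i.+4) q = ev (covec i.+4) p].
Proof.
have [hT hT' hD hS hi] := lightcone_J2; split=> [||||i hik] /=.
- exact: ev_mexp_kernel.
- exact: ev_mexp_kernel.
- by rewrite (@ev_mexp_eigen _ _ (-1)) ?mulrN1// hD scaleN1r.
- by rewrite (@ev_mexp_eigen _ _ 1) ?mulr1// hS scale1r.
- by apply: ev_mexp_kernel; exact: hi.
Qed.

(** The two-parameter group that moves t + y while fixing t - y and the x_i;
    the term in a * b comes from the square of the exponent. *)
Lemma mexp_ML (a b : R) p : let q := mexp (a *: M R l + b *: L R l) *m p in
  [/\ ev t_minus_y q = ev t_minus_y p,
  ev t_plus_y q = ev t_plus_y p - 2 * a * ev u_minus_x p
    - 2 * b * ev u_plus_x p - 4 * a * b * ev t_minus_y p,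
  ev u_minus_x q = ev u_minus_x p + 2 * b * ev t_minus_y p,
  ev u_plus_x q = ev u_plus_x p + 2 * a * ev t_minus_y p &
  forall i, (i < k)%N -> ev (covec i.+4) q = ev (covec i.+4) p].
Proof.
have [MT MT' MD MS Mi] := lightcone_M; have [LT LT' LD LS Li] := lightcone_L.
set X := _ + _.
have XT : t_minus_y *m X = 0.
  by rewrite mulmxDr -!scalemxAr MT LT !scaler0 addr0.
have XD : u_minus_x *m X = (2 * b) *: t_minus_y.
  by rewrite mulmxDr -!scalemxAr MD LD scaler0 add0r scalerA mulrC.
have XS : u_plus_x *m X = (2 * a) *: t_minus_y.
  by rewrite mulmxDr -!scalemxAr MS LS scaler0 addr0 scalerA mulrC.
have XT' : t_plus_y *m X = (- (2 * a)) *: u_minus_x + (- (2 * b)) *: u_plus_x.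
  by rewrite mulmxDr -!scalemxAr MT' LT' !scalerN !scalerA !scaleNr
    (mulrC a) (mulrC b).
have XT'2 : t_plus_y *m X *m X = (- (8 * a * b)) *: t_minus_y.
  rewrite XT' mulmxDl -!scalemxAl XD XS !scalerA -scalerDl.
  by congr (_ *: _); ring.
have Xi i : (i < k)%N -> covec i.+4 *m X = 0.
  by move=> hi; rewrite mulmxDr -!scalemxAr Mi// Li// !scaler0 addr0.
have XD2 : u_minus_x *m X *m X = 0 by rewrite XD -scalemxAl XT scaler0.
have XS2 : u_plus_x *m X *m X = 0 by rewrite XS -scalemxAl XT scaler0.
have XT'3 : t_plus_y *m X *m X *m X = 0.
  by rewrite XT'2 -scalemxAl XT scaler0.
split=> [||||i hik] /=; rewrite ev_mulmx mexp_nilpotent_row.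
- by rewrite XT mul0mx scaler0 !addr0.
- by rewrite XT !mul0mx.
- by rewrite XT'2 XT' !(evD, evZ); field.
- exact: XT'3.
- by rewrite XD2 XD scaler0 addr0 !(evD, evZ).
- by rewrite XD2 mul0mx.
- by rewrite XS2 XS scaler0 addr0 !(evD, evZ).
- by rewrite XS2 mul0mx.
- by rewrite Xi// mul0mx scaler0 !addr0.
- by rewrite Xi// !mul0mx.
Qed.

(** Inside the hyperplane t = y these elements act on x_3, x_4, ... and t + y
    by arbitrary translations proportional to u - x. *)
Lemma mexp_MV (a : R) (v : nat -> R) p :
  let q := mexp (a *: M R l + \sum_(i < k) v i *: V R l i.+4.+1) *m p in
  [/\ ev t_minus_y q = ev t_minus_y p,
  ev t_plus_y q = ev t_plus_y p - 2 * a * ev u_minus_x p,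
  ev u_minus_x q = ev u_minus_x p,
  ev t_minus_y p = 0 -> ev u_plus_x q = ev u_plus_x p
    + 2 * \sum_(i < k) v i * ev (covec i.+4) p
    + (\sum_(i < k) v i ^+ 2) * ev u_minus_x p &
  forall i, (i < k)%N ->
    ev (covec i.+4) q = ev (covec i.+4) p + v i * ev u_minus_x p].
Proof.
have [MT MT' MD MS Mi] := lightcone_M; set X := _ + _.
have sumV f (F : nat -> 'rV[R]_k.+4) :
    (forall i, (i < k)%N -> f *m V R l i.+4.+1 = F i) ->
    f *m (\sum_(i < k) v i *: V R l i.+4.+1) = \sum_(i < k) v i *: F i.
  move=> h; rewrite mulmx_sumr; apply: eq_bigr => i _.
  by rewrite -scalemxAr h.
have sumV0 f : (forall i, (i < k)%N -> f *m V R l i.+4.+1 = 0) ->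
    f *m (\sum_(i < k) v i *: V R l i.+4.+1) = 0.
  move=> /(sumV _ (fun=> 0)) ->.
  by rewrite big1// => i _; rewrite scaler0.
have XT : t_minus_y *m X = 0.
  rewrite mulmxDr -!scalemxAr MT scaler0 add0r sumV0// => i /lightcone_V.
  by case=> ->.
have XD : u_minus_x *m X = 0.
  rewrite mulmxDr -!scalemxAr MD scaler0 add0r sumV0// => i /lightcone_V.
  by case=> _ _ ->.
have XT' : t_plus_y *m X = (- (2 * a)) *: u_minus_x.
  rewrite mulmxDr -!scalemxAr MT' sumV0; last by move=> i /lightcone_V[_ ->].
  by rewrite addr0 scalerN scalerA scaleNr mulrC.
have Xi i : (i < k)%N -> covec i.+4 *m X = v i *: u_minus_x.
  move=> hi; rewrite mulmxDr -!scalemxAr Mi// scaler0 add0r.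
  rewrite (sumV _ (fun j => u_minus_x *+ (i == j))); last first.
    by move=> j /lightcone_V[_ _ _ _]; exact.
  rewrite (bigD1 (Ordinal hi))//= eqxx big1 ?addr0// => j.
  by rewrite -val_eqE /= eq_sym => /negPf ->; rewrite scaler0.
have XS : u_plus_x *m X =
    (2 * a) *: t_minus_y + 2 *: \sum_(i < k) v i *: covec i.+4.
  rewrite mulmxDr -!scalemxAr MS scalerA mulrC; congr (_ + _).
  rewrite (sumV _ (fun j => 2 *: covec j.+4)); last first.
    by move=> j /lightcone_V[_ _ _ ->].
  by rewrite scaler_sumr; apply: eq_bigr => i _; rewrite !scalerA mulrC.
have XS2 : u_plus_x *m X *m X = (2 * \sum_(i < k) v i ^+ 2) *: u_minus_x.
  rewrite XS mulmxDl -!scalemxAl XT scaler0 add0r -scalerA; congr (_ *: _).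
  rewrite mulmx_suml scaler_suml; apply: eq_bigr => i _.
  by rewrite -scalemxAl Xi// scalerA expr2.
have X2 f : f *m X *m X = 0 -> f *m mexp X = f + f *m X.
  by move=> h; rewrite mexp_nilpotent_row h ?mul0mx// scaler0 addr0.
split=> [|||T0|i hik] /=; rewrite ev_mulmx.
- by rewrite X2 XT ?mul0mx// addr0.
- by rewrite X2 XT' -?scalemxAl ?XD ?scaler0// evD evZ mulNr.
- by rewrite X2 XD ?mul0mx// addr0.
- rewrite mexp_nilpotent_row; last by rewrite XS2 -scalemxAl XD scaler0.
  rewrite XS2 XS !(evD, evZ) ev_sum T0 mulr0 add0r.
  by rewrite (eq_bigr _ (fun i _ => evZ _ _ p)); field.
- by rewrite X2 Xi// -?scalemxAl ?XD ?scaler0// evD evZ.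
Qed.

(** * The closed orbits of AN *)

Lemma continuous_ev f : continuous (ev f).
Proof.
have -> : ev f = fun p => (f *m p *m 1%:M) 0 0.
  by apply/funext => p; rewrite mulmx1.
move=> p; apply: (@cvg_pairing R _ _ _ (nbhs p) _ f 1%:M id p).
exact: cvg_id.
Qed.

Lemma base_lightcone : [/\ ev t_minus_y o = 0, ev t_plus_y o = 0,
  ev u_minus_x o = 1, ev u_plus_x o = 1 &
  forall i, (i < k)%N -> ev (covec i.+4) o = 0].
Proof.
have -> : o = delta_mx (inord 0) 0 :> 'cV[R]_k.+4.
  by congr (delta_mx _ _); apply/val_inj; rewrite /= inordK.
rewrite t_minus_yE t_plus_yE u_minus_xE u_plus_xE !(evD, evN).
rewrite !ev_covec_delta//=.
split; rewrite ?subr0 ?addr0 ?subrr//.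
by move=> i hi; rewrite ev_covec_delta.
Qed.

(** The null vector e_t - e_y; it is both the direction tangent to the basic
    light ray and the vector along which T varies alone. *)
Definition null_dir : 'cV[R]_k.+4 :=
  delta_mx (inord 1) 0 - delta_mx (inord 3) 0.

Lemma null_dir_lightcone : [/\ ev t_minus_y null_dir = 2,
  ev t_plus_y null_dir = 0,
  ev u_minus_x null_dir = 0, ev u_plus_x null_dir = 0 &
  forall i, (i < k)%N -> ev (covec i.+4) null_dir = 0].
Proof.
have wE f : ev f null_dir =
    ev f (delta_mx (inord 1) 0) - ev f (delta_mx (inord 3) 0).
  by rewrite ev_colD ev_colN.
split; last by move=> i hi; rewrite wE !ev_covec_delta//= subrr.
all: rewrite wE ?t_minus_yE ?t_plus_yE ?u_minus_xE ?u_plus_xE !(evD, evN).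
all: by rewrite !ev_covec_delta//=; ring.
Qed.

Lemma groupA_J1 (s : R) : groupA (mexp (s *: J1 R l)).
Proof.
by exists (s *: J1 R l) => //=; rewrite memvZ// memv_span// inE eqxx.
Qed.

Lemma groupA_J2 (s : R) : groupA (mexp (s *: J2 R l)).
Proof.
by exists (s *: J2 R l) => //=; rewrite memvZ// memv_span// !inE eqxx orbT.
Qed.

Lemma lieN_M : M R l \in lieN R l.
Proof. by rewrite memv_span// mem_cat !inE eqxx. Qed.
Lemma lieN_L : L R l \in lieN R l.
Proof. by rewrite memv_span// mem_cat !inE eqxx orbT. Qed.
Lemma lieN_V i : (i < k)%N -> V R l i.+4.+1 \in lieN R l.
Proof.
move=> hi; rewrite memv_span// !mem_cat; apply/orP; right.
by apply/orP; left; apply: map_f; rewrite mem_index_iota; lia.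
Qed.

Lemma AdS_u_minus_x_neq0 p : AdS (p : 'cV[R]_l.-1.+2) ->
  ev t_minus_y p = 0 -> ev u_minus_x p != 0.
Proof.
move=> /AdS_qform + T0; rewrite /qform T0 mul0r add0r.
apply: contra_eq_neq => ->.
rewrite mul0r sub0r lt_eqF// (le_lt_trans _ ltr01)// oppr_le0 sumr_ge0//.
by move=> i _; exact: sqr_ge0.
Qed.

(** Transitivity of AN on each half of the section t = y, for the two values
    s = 1 and s = -1.  From s *: o, the coordinates x_i and t + y are reached by
    an element of exp (span M V_i), then u - x is adjusted by a boost in J2;
    the equation of AdS then gives u + x the right value. *)
Lemma orbit_AN_base (s : R) p : s * s = 1 -> AdS (p : 'cV[R]_l.-1.+2) ->
  ev t_minus_y p = 0 -> 0 < s * ev u_minus_x p ->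
  orbit (AN : set 'M[R]_l.-1.+2) (s *: o) p.
Proof.
move=> ss Ap T0 sD; have D0 := AdS_u_minus_x_neq0 Ap T0.
move: Ap => /AdS_qform; rewrite /qform => Fp.
have s0 : s != 0 by apply: contraTneq sD => ->; rewrite mul0r ltxx.
pose v i := s * ev (covec i.+4) p; pose a := - (s * ev t_plus_y p) / 2.
pose t := - ln (s * ev u_minus_x p).
pose X := a *: M R l + \sum_(i < k) v i *: V R l i.+4.+1.
have XN : X \in lieN R l.
  rewrite memvD ?memvZ ?lieN_M// memv_suml// => i _.
  by rewrite memvZ ?lieN_V.
exists (mexp (t *: J2 R l) *m mexp X).
  exists (mexp (t *: J2 R l)); first exact: groupA_J2.
  by exists (mexp X) => //; exists X.
rewrite -mulmxA.
have [oT oT' oD oS oi] := base_lightcone.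
have [e1 e2 e3 e4 ei] := mexp_MV a v (s *: o).
have [h1 h2 h3 h4 hi] := mexp_J2 t (mexp X *m (s *: o)).
have ets : expR (- t) = s * ev u_minus_x p by rewrite opprK lnK.
have et : expR t = (s * ev u_minus_x p)^-1 by rewrite -ets -expRN opprK.
apply: ev_ext.
- by rewrite h1 e1 ev_colZ oT mulr0 T0.
- rewrite h2 e2 !ev_colZ oT' oD /a.
  by transitivity (s * s * ev t_plus_y p); [field|rewrite ss mul1r].
- by rewrite h3 e3 ev_colZ oD ets mulr1 mulrAC ss mul1r.
- rewrite h4 e4 ?ev_colZ ?oT ?mulr0// oS oD et big1; last first.
    by move=> i _; rewrite ev_colZ oi// !mulr0.
  have -> : \sum_(i < k) v i ^+ 2 = ev u_minus_x p * ev u_plus_x p - 1.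
    rewrite -Fp T0 mul0r add0r subKr; apply: eq_bigr => i _.
    by rewrite exprMn expr2 ss mul1r.
  by field; rewrite s0 D0.
- move=> i hik; rewrite hi// ei// !ev_colZ oi// oD /v.
  by rewrite mulr0 add0r mulr1 mulrAC ss mul1r.
Qed.

(** On AdS, D cannot vanish where T does, so the strict inequality defining the
    orbit may be replaced by a weak one. *)
Lemma closed_orbit_AN_base (s : R) : s * s = 1 ->
  closed (orbit (AN : set 'M[R]_l.-1.+2) (s *: o)
    : set (subspace (@AdS R l))).
Proof.
move=> ss; apply/closed_subspaceP.
have [oT oT' oD oS oi] := base_lightcone.
exists ((ev t_minus_y @^-1` [set x | x = 0]) `&`
        (ev (s *: u_minus_x) @^-1` [set x | 0 <= x])).
  by apply: closedI; apply: preimage_closed => // p _; exact: continuous_ev.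
apply/seteqP; split=> p /=.
  move=> [[T0 D0] Ap]; split=> //; apply: orbit_AN_base => //.
  rewrite evZ in D0; rewrite lt_neqAle D0 andbT eq_sym mulf_neq0//.
    by apply: contra_eq_neq ss => ->; rewrite mul0r eq_sym oner_neq0.
  exact: AdS_u_minus_x_neq0.
move=> [[b /AN_lightcone[x [y [z [x0 y0 bT bD]]]] <-] Ap]; split=> //; split.
  by rewrite ev_mulmx bT evZ ev_colZ oT !mulr0.
rewrite evZ ev_mulmx bD evD !evZ !ev_colZ oT oD !mulr0 addr0 mulr1.
by rewrite mulrCA ss mulr1 ltW.
Qed.

(** Once t + y = 0, rescaling t - y by y > 0 preserves the form, and the points
    q2 y of the orbit so obtained tend to q2 0, which has t - y = 0. *)
Lemma orbit_AN_not_closed q : AdS (q : 'cV[R]_l.-1.+2) -> ev t_minus_y q != 0 ->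
  ~ closed (orbit (AN : set 'M[R]_l.-1.+2) q : set (subspace (@AdS R l))).
Proof.
move=> /AdS_qform Fq Tq /closed_subspaceP[C Ccl CE].
(* The equation is affine in a, with leading coefficient - 2 (D + 2 b T): take
   b = 0 if D <> 0, and b = 1 otherwise. *)
have [a [b ab]] : exists a b, ev t_plus_y q - 2 * a * ev u_minus_x q
    - 2 * b * ev u_plus_x q - 4 * a * b * ev t_minus_y q = 0.
  have [D0|D0] := eqVneq (ev u_minus_x q) 0.
    exists ((ev t_plus_y q - 2 * ev u_plus_x q) / (4 * ev t_minus_y q)), 1.
    by rewrite D0; field.
  by exists (ev t_plus_y q / (2 * ev u_minus_x q)), 0; field.
pose X := a *: M R l + b *: L R l.
have XN : X \in lieN R l by rewrite memvD ?memvZ ?lieN_M ?lieN_L.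
have [T1 T1' D1 S1 i1] := mexp_ML a b q.
set q1 := mexp _ *m q in T1 T1' D1 S1 i1; rewrite ab in T1'.
have [wT wT' wD wS wi] := null_dir_lightcone.
move: (null_dir : 'cV[R]_k.+4) wT wT' wD wS wi => w wT wT' wD wS wi.
pose c := ev t_minus_y q / 2.
pose q2 (y : R) := (q1 - c *: w) + (y * c) *: w.
have ev2 y f : ev f (q2 y) = ev f q1 - c * ev f w + y * c * ev f w.
  by rewrite /q2 !ev_colD -scaleNr !ev_colZ mulNr.
have q2A y : AdS (q2 y : 'cV[R]_l.-1.+2).
  apply/AdS_qform; rewrite /qform !ev2 wT wT' wD wS T1' D1 S1 T1 -[RHS]Fq.
  rewrite (eq_bigr (fun i : 'I_k => ev (covec i.+4) q ^+ 2)).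
    move: ab; set A := _ - _ => ab.
    transitivity (qform q - ev t_minus_y q * A); last by rewrite ab mulr0 subr0.
    by rewrite /qform /A; ring.
  by move=> i _; rewrite ev2 wi// i1// !mulr0 subr0 addr0.
have q2C y : 0 < y -> C (q2 y).
  move=> y0; suff : (C `&` @AdS R l) (q2 y) by case.
  rewrite CE; split=> //.
  exists (mexp (- ln y *: J1 R l) *m mexp X).
    exists (mexp (- ln y *: J1 R l)); first exact: groupA_J1.
    by exists (mexp X) => //; exists X.
  rewrite -mulmxA -/q1; have [h1 h2 h3 h4 hi] := mexp_J1 (- ln y) q1.
  apply: ev_ext; rewrite ?ev2 ?h1 ?h2 ?h3 ?h4.
  - by rewrite opprK lnK// wT T1 /c; field.
  - by rewrite wT' T1'; ring.
  - by rewrite wD; ring.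
  - by rewrite wS; ring.
  - by move=> i hik; rewrite hi// ev2 wi//; ring.
have : C (q2 0).
  apply: (@closed_cvg _ _ (0^'+) _ q2 C Ccl); last first.
    apply: cvg_at_right_filter.
    apply: cvgD; first exact: cvg_cst.
    apply: cvgZ; last exact: cvg_cst.
    by apply: cvgM; [exact: cvg_id|exact: cvg_cst].
  near=> y; apply: q2C; near: y; exact: nbhs_right_gt.
move=> C0; have : (C `&` @AdS R l) (q2 0) by split.
rewrite CE => -[[d /AN_lightcone[x [y [z [x0 y0 bT bD]]]] dE] _].
have := ev2 0 t_minus_y; rewrite -dE ev_mulmx bT evZ wT T1 /c.
rewrite [RHS](_ : _ = 0); last by field.
by move/eqP; rewrite mulf_eq0 (negPf Tq) (gt_eqF x0).
Unshelve. all: by end_near.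
Qed.

(** * The reflection eta and the singularity *)

Let eta_sign (i : nat) : R := if (i < 2)%N then 1 else -1.

Lemma eta_diag : eta = diag_mx (\row_(i < k.+4) eta_sign i).
Proof.
apply/matrixP => i j; rewrite /Defs.eta [LHS]mxE.
rewrite [RHS]mxE mxE /eta_sign.
case: splitP => i' hi'; rewrite mxE; case: splitP => j' hj'; rewrite !mxE.
- have -> : (i' == j') = (i == j) by rewrite -!val_eqE /= hi' hj'.
  by rewrite hi' ltn_ord.
- rewrite -val_eqE /= hi' hj' (_ : (_ == _) = false)//=.
  by have := ltn_ord i'; lia.
- rewrite -val_eqE /= hi' hj' (_ : (_ == _) = false)//=.
  by have := ltn_ord j'; lia.
- have -> : (i' == j') = (i == j).
    by rewrite -!val_eqE /= hi' hj' /= eqn_add2l.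
  by rewrite hi' /= mulNrn.
Qed.

Lemma eta_sqr : eta *m eta = 1%:M.
Proof.
rewrite eta_diag mulmx_diag -diag_const_mx; congr diag_mx; apply/rowP => j.
by rewrite !mxE /eta_sign; case: ifP => _; ring.
Qed.

Lemma covec_eta a : (a < k.+4)%N -> covec a *m eta = eta_sign a *: covec a.
Proof.
move=> ha; rewrite eta_diag; apply/rowP => j; rewrite mul_mx_diag.
rewrite !mxE mulrC eqxx /=.
by case: eqVneq => [->|]; rewrite ?inordK// !mulr0.
Qed.

Lemma t_minus_y_eta : t_minus_y *m eta = t_plus_y.
Proof.
rewrite t_minus_yE t_plus_yE mulmxBl !covec_eta// /eta_sign /=.
by rewrite scale1r scaleN1r opprK.
Qed.

Lemma eta_conj_E a b : (a < k.+4)%N -> (b < k.+4)%N ->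
  eta *m E R l a.+1 b.+1 *m eta = (eta_sign a * eta_sign b) *: E R l a.+1 b.+1.
Proof.
move=> ha hb; rewrite eta_diag mul_mx_diag mul_diag_mx; apply/matrixP => i j.
rewrite !mxE.
case: eqVneq => [->|]; last by rewrite !(mulr0, mul0r).
by case: eqVneq => [->|] /=; rewrite ?inordK ?(mulr0, mul0r)//; ring.
Qed.

Lemma trmx_E (a b : nat) : (E R l a b)^T = E R l b a.
Proof. exact: trmx_delta. Qed.

(** On so(2, n), the condition tr X eta + eta X = 0 says that
    theta X = - tr X is conjugation by eta; it is checked on the generators. *)
Lemma theta_eta X : X \in lieN R l -> @theta R l X = eta *m X *m eta.
Proof.
move: X; apply: lieN_ind => [|a X Y hX hY||| |].
- by rewrite /theta trmx0 oppr0 mulmx0 mul0mx.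
- rewrite mulmxDr mulmxDl -scalemxAr -scalemxAl -hX -hY /theta.
  by rewrite linearD linearZ /= opprD scalerN.
- rewrite /theta eta_diag mul_mx_diag mul_diag_mx; apply/matrixP => i j.
  rewrite !mxE /eta_sign; case: i j => [[|[|[|[|i]]]] hi] [[|[|[|[|j]]]] hj] /=;
    by rewrite ?nth_nil; ring.
- rewrite /theta eta_diag mul_mx_diag mul_diag_mx; apply/matrixP => i j.
  rewrite !mxE /eta_sign; case: i j => [[|[|[|[|i]]]] hi] [[|[|[|[|j]]]] hj] /=;
    by rewrite ?nth_nil; ring.
- move=> i hi; rewrite /V !(mulmxDr, mulmxDl, mulmxN, mulNmx) !eta_conj_E//.
  rewrite /theta !(linearD, linearN) /= !trmx_E /eta_sign /=.
  move: (E _ _ 1 _) (E _ _ 3 _) (E _ _ _ 1) (E _ _ _ 3) => e1 e2 e3 e4.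
  by apply/matrixP => x y; rewrite !mxE; ring.
- move=> i hi; rewrite /W !(mulmxDr, mulmxDl, mulmxN, mulNmx) !eta_conj_E//.
  rewrite /theta !(linearD, linearN) /= !trmx_E /eta_sign /=.
  move: (E _ _ 2 _) (E _ _ 4 _) (E _ _ _ 2) (E _ _ _ 4) => e1 e2 e3 e4.
  by apply/matrixP => x y; rewrite !mxE; ring.
Qed.

Lemma lieA_eta X : X \in lieA R l -> eta *m X *m eta = - X.
Proof.
move: X; apply: lieA_ind => [|a X Y hX hY||].
- by rewrite mulmx0 mul0mx oppr0.
- by rewrite mulmxDr mulmxDl -scalemxAr -scalemxAl hX hY scalerN opprD.
- rewrite /J1 !(mulmxDr, mulmxDl) !eta_conj_E// /eta_sign /=.
  by rewrite mul1r mulr1 !scaleN1r opprD.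
- rewrite /J2 !(mulmxDr, mulmxDl) !eta_conj_E// /eta_sign /=.
  by rewrite mul1r mulr1 !scaleN1r opprD.
Qed.

Lemma eta_conjK X : eta *m (eta *m X *m eta) *m eta = X.
Proof. by rewrite !mulmxA eta_sqr mul1mx -mulmxA eta_sqr mulmx1. Qed.

Lemma groupA_eta (g : 'M[R]_k.+4) : groupA (g : 'M[R]_l.-1.+2) ->
  groupA (eta *m g *m eta : 'M[R]_l.-1.+2).
Proof.
move=> [X XA <-]; exists (- X); first by rewrite /= memvN.
by rewrite -(lieA_eta XA) mexp_conj// eta_sqr.
Qed.

Lemma groupNbar_conj (g : 'M[R]_k.+4) : groupNbar (g : 'M[R]_l.-1.+2) <->
  groupN (eta *m g *m eta : 'M[R]_l.-1.+2).
Proof.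
split=> [[_ [X XN <-] <-]|[X XN XE]].
  exists X => //; rewrite (theta_eta XN) mexp_conj ?eta_sqr//.
  by rewrite eta_conjK.
exists (@theta R l X); first by exists X.
by rewrite (theta_eta XN) mexp_conj ?eta_sqr// XE eta_conjK.
Qed.

Definition ANbar : set 'M[R]_k.+4 := setM (@groupA R l) (@groupNbar R l).

(** Conjugation by eta inverts A and maps N to its opposite, so it carries the
    orbits of one Iwasawa subgroup to those of the other. *)
Lemma ANbar_conj (b : 'M[R]_k.+4) : ANbar b <-> AN (eta *m b *m eta).
Proof.
split=> [[g gA [h hN <-]]|[g gA [h hN hE]]].
  exists (eta *m g *m eta); first exact: groupA_eta.
  exists (eta *m h *m eta); first exact/groupNbar_conj.
  by rewrite !mulmxA -(mulmxA _ eta eta) eta_sqr mulmx1.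
exists (eta *m g *m eta); first exact: groupA_eta.
exists (eta *m h *m eta); first by apply/groupNbar_conj; rewrite eta_conjK.
rewrite -[b]eta_conjK -hE.
by rewrite !mulmxA -(mulmxA _ eta eta) eta_sqr mulmx1.
Qed.

Lemma orbit_ANbar p : orbit (ANbar : set 'M[R]_l.-1.+2) p =
  (mulmx eta) @^-1` orbit (AN : set 'M[R]_l.-1.+2) (eta *m p).
Proof.
apply/seteqP; split=> q /= [b bA].
  move=> <-; exists (eta *m b *m eta); first exact/ANbar_conj.
  by rewrite -!mulmxA (mulmxA eta eta) eta_sqr mul1mx.
move=> bE; exists (eta *m b *m eta).
  by apply/ANbar_conj; rewrite eta_conjK.
by rewrite -!mulmxA bE mulmxA eta_sqr mul1mx.
Qed.

Lemma AdS_eta p : AdS (eta *m p : 'cV[R]_l.-1.+2) <-> AdS (p : 'cV[R]_l.-1.+2).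
Proof.
have etap i : (eta *m p) i 0 = eta_sign i * p i 0.
  by rewrite eta_diag mul_diag_mx !mxE.
rewrite /AdS /=; under eq_bigr do rewrite etap.
have -> : (eta *m p) 0 0 = p 0 0 by rewrite etap mul1r.
have -> : (eta *m p) 1 0 = p 1 0 by rewrite etap mul1r.
by under eq_bigr do rewrite mulN1r sqrrN.
Qed.

Lemma closed_preimage_eta (O : set 'cV[R]_k.+4) :
  closed (O : set (subspace (@AdS R l))) ->
  closed (mulmx eta @^-1` O : set (subspace (@AdS R l))).
Proof.
move=> /closed_subspaceP[C Ccl CE]; apply/closed_subspaceP.
exists (mulmx eta @^-1` C).
  by apply: preimage_closed => // p _; exact: continuous_mulmx.
apply/seteqP; split=> p [/= Cp Ap]; split=> //.
  suff : (O `&` @AdS R l) (eta *m p) by case.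
  by rewrite -CE; split=> //; exact/AdS_eta.
suff : (C `&` @AdS R l) (eta *m p) by case.
by rewrite CE; split=> //; exact/AdS_eta.
Qed.

Lemma etaK p : eta *m (eta *m p) = p.
Proof. by rewrite mulmxA eta_sqr mul1mx. Qed.

Lemma orbit_AN_hyperplane p : AdS (p : 'cV[R]_l.-1.+2) -> ev t_minus_y p = 0 ->
  exists s : R, s * s = 1 /\
    orbit (AN : set 'M[R]_l.-1.+2) (s *: o) p.
Proof.
move=> Ap T0.
have D0 := AdS_u_minus_x_neq0 Ap T0.
pose s := Num.sg (ev u_minus_x p); exists s; have ss : s * s = 1.
  by rewrite -expr2 sqr_sg D0.
split=> //; apply: orbit_AN_base => //.
by rewrite -normrEsg normr_gt0.
Qed.

Lemma AdS_base (s : R) : s * s = 1 -> AdS (s *: o : 'cV[R]_l.-1.+2).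
Proof.
move=> ss; apply/AdS_qform; rewrite /qform !ev_colZ.
have [-> -> -> -> oi] := base_lightcone.
rewrite big1; first by rewrite -[RHS]ss; ring.
by move=> i _; rewrite ev_colZ oi// mulr0 expr0n.
Qed.

Lemma lightcone_singularity p : AdS (p : 'cV[R]_l.-1.+2) ->
  ev t_minus_y p = 0 \/ ev t_plus_y p = 0 -> singularity (p : 'cV[R]_l.-1.+2).
Proof.
move=> Ap [T0|T'0].
  have [s [ss op]] := orbit_AN_hyperplane Ap T0.
  exists (orbit (AN : set 'M[R]_l.-1.+2) (s *: o)) => //.
  by left; split; [exists (s *: o) => //; exact: AdS_base|
    exact: closed_orbit_AN_base].
have [|s [ss op]] := @orbit_AN_hyperplane (eta *m p) (iffRL (AdS_eta p) Ap).
  by rewrite ev_mulmx t_minus_y_eta.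
exists (orbit (ANbar : set 'M[R]_l.-1.+2) (eta *m (s *: o))); last first.
  by rewrite orbit_ANbar /= etaK.
right; split.
  exists (eta *m (s *: o)) => //.
  exact/AdS_eta/AdS_base.
rewrite orbit_ANbar etaK; apply: closed_preimage_eta.
exact: closed_orbit_AN_base.
Qed.

Lemma orbit_t_minus_y q p : ev t_minus_y q = 0 ->
  orbit (AN : set 'M[R]_l.-1.+2) q p -> ev t_minus_y p = 0.
Proof.
move=> Tq [b /AN_lightcone[x [y [z [_ _ bT _]]]] <-].
by rewrite ev_mulmx bT evZ Tq mulr0.
Qed.

Lemma singularity_lightcone p : singularity (p : 'cV[R]_l.-1.+2) ->
  ev t_minus_y p = 0 \/ ev t_plus_y p = 0.
Proof.
move=> [C [[[q Aq ->] Ocl]|[[q Aq ->] Ocl]] Op].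
  left; apply: orbit_t_minus_y Op; apply/eqP.
  by case: eqP => // /eqP Tq; case: (orbit_AN_not_closed Aq Tq Ocl).
move: Op; rewrite -/ANbar orbit_ANbar /= => Op; right.
rewrite -t_minus_y_eta -ev_mulmx; apply: orbit_t_minus_y Op; apply/eqP.
case: eqP => // /eqP Tq; case: (@orbit_AN_not_closed _ _ Tq).
  exact/AdS_eta.
move: Ocl; rewrite -/ANbar orbit_ANbar => /closed_preimage_eta.
by congr closed; apply/seteqP; split=> x /=; rewrite etaK.
Qed.

(** * Light rays *)

(** The columns of time part (u, t) = a and space part (x_1, x_2, ...) = b. *)
Definition spacetime (a : 'cV[R]_2) (b : 'cV[R]_k.+2) : 'cV[R]_k.+4 :=
  col_mx a b.

Definition lorentz p q : R := (p^T *m eta *m q) 0 0.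

Lemma lorentz_spacetime a b c d : lorentz (spacetime a b) (spacetime c d) =
  (a^T *m c) 0 0 - (b^T *m d) 0 0.
Proof.
rewrite -[LHS]/(((col_mx a b)^T *m
  (block_mx 1%:M 0 0 (- 1%:M) : 'M[R]_(2 + k.+2)) *m col_mx c d) 0 0).
rewrite tr_col_mx mul_row_block !mulmx0 addr0 add0r.
by rewrite mulmx1 mulmxN mulmx1 mul_row_col mulNmx !mxE.
Qed.

Lemma spacetime_split p : p = spacetime
  (usubmx (p : 'cV_(2 + k.+2))) (dsubmx (p : 'cV_(2 + k.+2))).
Proof. by rewrite /spacetime vsubmxK. Qed.

Lemma AdS_lorentz p : AdS (p : 'cV[R]_l.-1.+2) <-> lorentz p p = 1.
Proof.
suff -> : lorentz p p = p 0 0 ^+ 2 + p 1 0 ^+ 2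
    - \sum_(i < k.+2) p (rshift 2 i : 'I_k.+4) 0 ^+ 2 by [].
rewrite {1 2}[p]spacetime_split lorentz_spacetime !sum_sqr_dot; congr (_ - _).
  rewrite !big_ord_recl big_ord0 addr0 !mxE.
  by congr (p _ 0 ^+ 2 + p _ 0 ^+ 2); apply/val_inj.
by apply: eq_bigr => i _; rewrite mxE.
Qed.

Lemma lorentz_SO g p q : SO2n (g : 'M[R]_l.-1.+2) ->
  lorentz (g *m p) (g *m q) = lorentz p q.
Proof.
move=> [gg _]; rewrite /lorentz trmx_mul -!mulmxA (mulmxA g^T) (mulmxA _ g).
by rewrite gg mulmxA.
Qed.

Lemma AdS_SO g p : SO2n (g : 'M[R]_l.-1.+2) -> AdS (p : 'cV[R]_l.-1.+2) ->
  AdS (g *m p : 'cV[R]_l.-1.+2).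
Proof. by move=> gS /AdS_lorentz Ap; apply/AdS_lorentz; rewrite lorentz_SO. Qed.

Lemma spacetimeD a b c d :
  spacetime a b + spacetime c d = spacetime (a + c) (b + d).
Proof. exact: (@add_col_mx _ 2 k.+2 1). Qed.

Lemma spacetimeZ (x : R) a b : x *: spacetime a b = spacetime (x *: a) (x *: b).
Proof. exact: (@scale_col_mx _ 2 k.+2 1). Qed.

Definition time_dir : 'cV[R]_2 := delta_mx 1 0.
Definition y_dir : 'cV[R]_k.+2 := delta_mx 1 0.

Lemma spacetime_o : o = spacetime (delta_mx 0 0) 0.
Proof.
apply/colP => i; rewrite /spacetime !mxE; case: splitP => j ij; rewrite !mxE.
  by rewrite -!val_eqE /= ij.
by rewrite -!val_eqE /= ij.
Qed.

Lemma spacetime_t : delta_mx (inord 1) 0 = spacetime time_dir 0.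
Proof.
apply/colP => i; rewrite /spacetime !mxE; case: splitP => j ij; rewrite !mxE.
  by rewrite -!val_eqE /= inordK// ij.
by rewrite -!val_eqE /= inordK// ij.
Qed.

Lemma spacetime_y : delta_mx (inord 3) 0 = spacetime 0 y_dir.
Proof.
apply/colP => i; rewrite /spacetime !mxE; case: splitP => j ij; rewrite !mxE.
  rewrite -!val_eqE /= inordK// ij (_ : (_ == _) = false)//.
  by have := ltn_ord j; lia.
by rewrite -!val_eqE /= inordK// ij.
Qed.

Lemma null_dirE : null_dir = spacetime time_dir (- y_dir).
Proof.
rewrite /null_dir spacetime_t spacetime_y -scaleN1r spacetimeZ spacetimeD.
by rewrite scaler0 addr0 scaleN1r add0r.
Qed.

Lemma spacetime_x : delta_mx (inord 2) 0 = spacetime 0 (delta_mx 0 0).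
Proof.
apply/colP => i; rewrite /spacetime !mxE; case: splitP => j ij; rewrite !mxE.
  rewrite -!val_eqE /= inordK// ij (_ : (_ == _) = false)//.
  by have := ltn_ord j; lia.
by rewrite -!val_eqE /= inordK// ij.
Qed.

Lemma lightE_o : lightE R l *m o = - null_dir.
Proof.
have -> : o = delta_mx (inord 0) 0 :> 'cV[R]_k.+4.
  by congr (delta_mx _ _); apply/val_inj; rewrite /= inordK.
rewrite /lightE /null_dir !(mulmxDl, mulNmx) /E !mul_delta_mx_cond !inord_eq//=.
by rewrite !mulr0n !mulr1n add0r addr0 opprB addrC.
Qed.

Lemma lightE_null_dir : lightE R l *m null_dir = 0.
Proof.
rewrite /lightE /null_dir !(mulmxDl, mulmxDr, mulNmx, mulmxN) /E.
rewrite !mul_delta_mx_cond !inord_eq//=.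
by rewrite !mulr0n !mulr1n !(addr0, add0r, oppr0, opprK) addrN.
Qed.

Definition diag_block (A : 'M[R]_2) (B : 'M[R]_k.+2) : 'M[R]_k.+4 :=
  block_mx A 0 0 B.

Lemma block_spacetime A B a b :
  diag_block A B *m spacetime a b = spacetime (A *m a) (B *m b).
Proof.
rewrite -[LHS]/((block_mx A 0 0 B : 'M[R]_(2 + k.+2)) *m col_mx a b).
by rewrite mul_block_col !mul0mx addr0 add0r.
Qed.

Lemma block_SO A B : A^T *m A = 1%:M -> B^T *m B = 1%:M ->
  \det A = 1 -> \det B = 1 -> SO2n (diag_block A B : 'M[R]_l.-1.+2).
Proof.
move=> AA BB dA dB; split; last first.
  by rewrite [LHS](@det_ublock _ 2 k.+2) dA dB mulr1.
rewrite -[LHS]/((block_mx A 0 0 B : 'M[R]_(2 + k.+2))^T *m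
    block_mx 1%:M 0 0 (- 1%:M) *m block_mx A 0 0 B).
rewrite tr_block_mx !mulmx_block.
rewrite !(mulmx0, mul0mx, addr0, add0r, trmx0, mulmx1, mulmxN, mulNmx, oppr0).
by rewrite AA BB.
Qed.

Lemma K_H_spacetime K : K_H (K : 'M[R]_l.-1.+2) -> exists Om : 'M[R]_k.+2,
  [/\ SO2n (K : 'M[R]_l.-1.+2), K \in unitmx &
  forall a b, K *m spacetime a b = spacetime a (Om *m b)].
Proof.
move=> [Om [/= OO dO] <-]; exists Om; split.
- by apply: block_SO; rewrite ?det1// trmx1 mulmx1.
- rewrite unitmxE [X in X \is a _](@det_ublock _ 2 k.+2) det1 dO.
  by rewrite mulr1 unitr1.
- by move=> a b; rewrite [LHS]block_spacetime mul1mx.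
Qed.

(** As K fixes o and E (E o) = 0, the exponential series applied to o stops
    after its linear term: light rays are straight lines. *)
Lemma ray_point g K (s : R) : K_H (K : 'M[R]_l.-1.+2) ->
  @proj R l (g *m mexp (- s *: Ad (K : 'M[R]_l.-1.+2) (lightE R l))) =
  g *m (o + s *: (K *m null_dir)).
Proof.
move=> /K_H_spacetime[Om [_ ku kE]]; rewrite /proj -mulmxA; congr (_ *m _).
set w := null_dir.
pose Y : 'M[R]_k.+4 := - s *: Ad (K : 'M[R]_l.-1.+2) (lightE R l).
have ko : invmx K *m o = o.
  have kko : K *m o = o by rewrite spacetime_o kE mulmx0.
  by rewrite -{1}kko mulKmx.
have Yo : Y *m o = s *: (K *m w).
  rewrite /Y /Ad -scalemxAl -!mulmxA ko lightE_o -/w mulmxN.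
  by rewrite scalerN scaleNr opprK.
rewrite -/Y mexp_nilpotent_col Yo//.
rewrite -scalemxAr /Y /Ad -scalemxAl -!mulmxA mulKmx// lightE_null_dir.
by rewrite mulmx0 !scaler0.
Qed.

(** * Interior points and the event horizon *)

Definition quarter_turn : 'M[R]_2 := delta_mx 1 0 - delta_mx 0 1.

Definition rotation (c s : R) : 'M[R]_k.+4 :=
  diag_block (c%:M + s *: quarter_turn) 1%:M.

Lemma quarter_turnT : quarter_turn^T = - quarter_turn.
Proof. by rewrite /quarter_turn linearB /= !trmx_delta opprB. Qed.

Lemma quarter_turn_sqr : quarter_turn *m quarter_turn = - 1%:M.
Proof.
apply/matrixP => i j; rewrite !mxE !big_ord_recl big_ord0 !mxE.
by case: i => [[|[|i]] hi]; case: j => [[|[|j]] hj] //=; ring.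
Qed.

Lemma plane_rotation_orthogonal (c s : R) : c ^+ 2 + s ^+ 2 = 1 ->
  (c%:M + s *: quarter_turn)^T *m (c%:M + s *: quarter_turn) = 1%:M.
Proof.
move=> cs1.
have -> : (c%:M + s *: quarter_turn)^T = c%:M - s *: quarter_turn.
  by rewrite linearD linearZ /= tr_scalar_mx quarter_turnT scalerN.
rewrite mulmxBl !mulmxDr !mul_scalar_mx -!scalemxAl -!scalemxAr mul_mx_scalar.
rewrite quarter_turn_sqr; transitivity ((c ^+ 2 + s ^+ 2)%:M : 'M[R]_2).
  move: quarter_turn => J.
  by apply/matrixP => i j; rewrite !mxE; case: (i == j); ring.
by rewrite cs1.
Qed.

Lemma plane_rotation_det (c s : R) : c ^+ 2 + s ^+ 2 = 1 ->
  \det (c%:M + s *: quarter_turn) = 1.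
Proof.
move=> <-; rewrite (expand_det_row _ 0) !big_ord_recl big_ord0.
by rewrite /cofactor !det_mx11 !mxE /=; ring.
Qed.

Lemma rotation_SO (c s : R) : c ^+ 2 + s ^+ 2 = 1 ->
  SO2n (rotation c s : 'M[R]_l.-1.+2).
Proof.
move=> cs1; apply: block_SO; rewrite ?trmx1 ?mulmx1 ?det1//.
  exact: plane_rotation_orthogonal.
exact: plane_rotation_det.
Qed.

Lemma rotation_spacetime (c s : R) a b :
  rotation c s *m spacetime a b = spacetime ((c%:M + s *: quarter_turn) *m a) b.
Proof. by rewrite block_spacetime mul1mx. Qed.

(** The circle of rotations is connected and contains the identity. *)
Lemma rotation_G (t : R) : G (rotation (cos t) (sin t) : 'M[R]_l.-1.+2).
Proof.
pose rot (t : R) : 'M[R]_l.-1.+2 := rotation (cos t) (sin t).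
have : range rot (rot t) by exists t.
apply: connected_component_max.
- exists 0 => //; rewrite /rot /rotation cos0 sin0 scale0r addr0.
  by rewrite /diag_block -(@scalar_mx_block _ 2 k.+2).
- by move=> _ [x _ <-]; apply: rotation_SO; exact: cos2Dsin2.
- apply: connected_continuous_connected.
    by apply/connected_intervalP => x y _ _ z _.
  apply: continuous_subspaceT.
  have rotE : rot = fun x => cos x *: (block_mx 1%:M 0 0 0 : 'M[R]_(2 + k.+2))
      + sin x *: (block_mx quarter_turn 0 0 0 : 'M[R]_(2 + k.+2))
      + (block_mx 0 0 0 1%:M : 'M[R]_(2 + k.+2)).
    apply/funext => x; rewrite !scale_block_mx !add_block_mx !scaler0.
    by rewrite !addr0 !add0r scalemx1.
  rewrite rotE => x; apply: cvgD; last exact: cvg_cst.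
  apply: cvgD; (apply: cvgZ; last exact: cvg_cst).
    exact: continuous_cos.
  exact: continuous_sin.
Qed.

Lemma rotation_o (c s : R) : rotation c s *m o = c *: o + s *: e_ 1.
Proof.
rewrite spacetime_o rotation_spacetime spacetime_t.
rewrite !spacetimeZ !spacetimeD !scaler0 addr0; congr spacetime.
rewrite mulmxDl mul_scalar_mx -scalemxAl; congr (_ + _ *: _).
by rewrite /quarter_turn mulmxBl !mul_delta_mx_cond /= subr0.
Qed.

Lemma rotation_t (c s : R) : rotation c s *m e_ 1 = - s *: o + c *: e_ 1.
Proof.
rewrite spacetime_o  spacetime_t rotation_spacetime.
rewrite !spacetimeZ !spacetimeD !scaler0 addr0; congr spacetime.
rewrite mulmxDl mul_scalar_mx -scalemxAl addrC scaleNr -scalerN.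
congr (_ *: _ + _).
by rewrite /quarter_turn mulmxBl !mul_delta_mx_cond /= sub0r.
Qed.

Lemma AdS_ray (b : R) : AdS (o + b *: null_dir : 'cV[R]_l.-1.+2).
Proof.
have [oT oT' oD oS oi] := base_lightcone.
have [wT wT' wD wS wi] := null_dir_lightcone.
apply/AdS_qform; rewrite /qform !ev_colD !ev_colZ oT oT' oD oS wT wT' wD wS.
rewrite big1; first by ring.
by move=> i _; rewrite ev_colD ev_colZ oi// wi// mulr0 addr0 expr0n.
Qed.

Lemma spacetime_entry1 (a : 'cV[R]_2) b :
  spacetime a b (inord 1 : 'I_k.+4) 0 = a 1 0.
Proof.
rewrite /spacetime -(col_mxEu a b); congr (col_mx a b _ _).
by apply/val_inj; rewrite /= inordK.
Qed.

Lemma spacetime_entry3 (a : 'cV[R]_2) b :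
  spacetime a b (inord 3 : 'I_k.+4) 0 = b 1 0.
Proof.
rewrite /spacetime -(col_mxEd a b); congr (col_mx a b _ _).
by apply/val_inj; rewrite /= inordK.
Qed.

(** In the direction of y-component u, the ray has t = s + b c and y = - b u at
    time b, so it reaches t^2 = y^2 when s + b c = b |u|. *)
Lemma interior_rotation (c s : R) : c ^+ 2 + s ^+ 2 = 1 -> c < 0 -> 0 < s ->
  G (rotation c s : 'M[R]_l.-1.+2) ->
  interior_region (c *: o + s *: e_ 1 : 'cV[R]_l.-1.+2).
Proof.
move=> cs1 c0 s0 gG; rewrite -rotation_o; exists (rotation c s) => //.
split=> //.
move=> K kkK; have [Om [kS _ kE]] := K_H_spacetime kkK.
pose u := Om 1 1.
pose b : R := s / (`|u| - c).
have bc : 0 < `|u| - c by rewrite subr_gt0 (lt_le_trans c0).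
have b0 : 0 < b by rewrite divr_gt0.
pose q : 'cV[R]_k.+4 := rotation c s *m (o + b *: (K *m null_dir)).
exists q; split; first by exists b => //; rewrite ray_point.
have kw : K *m null_dir = e_ 1 - spacetime 0 (Om *m y_dir).
  rewrite null_dirE kE spacetime_t -[- spacetime _ _]scaleN1r.
  by rewrite spacetimeZ spacetimeD scaler0 addr0 add0r scaleN1r mulmxN.
have qE : q = (c - b * s) *: o + (s + b * c) *: e_ 1
    - b *: spacetime 0 (Om *m y_dir).
  rewrite /q mulmxDr rotation_o -scalemxAr kw mulmxBr rotation_t.
  rewrite rotation_spacetime mulmx0.
  move: (spacetime 0 _) (o : 'cV[R]_k.+4) (e_ 1) => x1 x2 x3.
  by apply/colP => i; rewrite !mxE; ring.
apply: lightcone_singularity.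
  apply: AdS_SO; first exact: rotation_SO.
  have -> : o = K *m o by rewrite {2}spacetime_o kE mulmx0 -spacetime_o.
  rewrite scalemxAr -mulmxDr; apply: AdS_SO => //; exact: AdS_ray.
have coT f : ev f q = (c - b * s) * ev f o + (s + b * c) * ev f (e_ 1)
    - b * ev f (spacetime 0 (Om *m y_dir)).
  by rewrite qE !ev_colD ev_colN !ev_colZ.
have [oT oT' _ _ _] := base_lightcone.
have S1 : spacetime 0 (Om *m y_dir) (inord 1) 0 = 0.
  by rewrite spacetime_entry1 mxE.
have S3 : spacetime 0 (Om *m y_dir) (inord 3) 0 = u.
  by rewrite spacetime_entry3 -colE mxE.
rewrite !coT oT oT' t_minus_yE t_plus_yE !(evD, evN) !ev_covec_delta//=.
rewrite !ev_covec S1 S3.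
have bu : s + b * c = b * `|u| by rewrite /b; field; rewrite gt_eqF.
rewrite bu; have [u0|u0] := ler0P u.
  by left; ring.
by right; ring.
Qed.

(** The null vector n = e_u + e_x is orthogonal to e_t, so v = g^-1 n is a null
    vector orthogonal to o, hence a nonzero multiple (possibly negative) of
    e_t + w for a unit space vector w.  A rotation in K_H carries e_t - e_y to
    e_t + w.  The corresponding ray from e_t has direction proportional to n,
    and t = 1, y = 0 all along it. *)
Lemma t_axis_not_interior : ~ interior_region (e_ 1 : 'cV[R]_l.-1.+2).
Proof.
move=> [g [gG ray] go].
have gS : SO2n g by exact: connected_component_sub gG.
pose gi := eta *m (g^T *m eta).
have gig : gi *m g = 1%:M.
  by case: gS => gg _; rewrite /gi -mulmxA gg eta_sqr.
have ggi : (g : 'M[R]_k.+4) *m gi = 1%:M by exact: mulmx1C.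
pose n := o + e_ 2; pose v := gi *m n.
have gv : (g : 'M[R]_k.+4) *m v = n by rewrite mulmxA ggi mul1mx.
have vE := spacetime_split v; set a := usubmx _ in vE; set b := dsubmx _ in vE.
have nE : n = spacetime (delta_mx 0 0) (delta_mx 0 0).
  by rewrite /n spacetime_x spacetime_o spacetimeD addr0 add0r.
have a0 : a 0 0 = 0.
  have : lorentz o v = lorentz (e_ 1) n by rewrite -(lorentz_SO _ _ gS) gv -go.
  rewrite spacetime_o vE spacetime_t nE !lorentz_spacetime !trmx_delta !trmx0.
  by rewrite !mul0mx -rowE mul_delta_mx_cond !mxE !subr0.
have ab : a 1 0 ^+ 2 = (b^T *m b) 0 0.
  have : lorentz v v = lorentz n n by rewrite -(lorentz_SO _ _ gS) gv.
  rewrite vE nE !lorentz_spacetime !trmx_delta !mul_delta_mx.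
  rewrite [X in _ = X - X]mxE subrr sum_sqr_dot !big_ord_recl big_ord0 a0.
  rewrite expr0n add0r addr0.
  move=> /eqP; rewrite subr_eq0 => /eqP <-.
  by congr (a _ 0 ^+ 2); apply/val_inj.
have a1 : a 1 0 != 0.
  apply/eqP => a10.
  have b0 : b = 0 by apply: dot_eq0; rewrite -ab a10 expr0n.
  have v0 : v = 0.
    rewrite vE b0 (_ : a = 0) /spacetime ?col_mx0//.
    apply/colP => i; rewrite [RHS]mxE.
    suff [->|->] : i = 0 \/ i = 1 by [].
    by case: i => [[|[|i]] hi] //; [left|right]; exact/val_inj.
  have : ev u_plus_x n = 0 by rewrite -gv v0 mulmx0 /ev mulmx0 mxE.
  have [_ _ _ oS _] := base_lightcone.
  rewrite /n ev_colD oS u_plus_xE evD !ev_covec_delta//= add0r -mulr2n => /eqP.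
  by rewrite pnatr_eq0.
have uu : (- (a 1 0)^-1 *: b)^T *m (- (a 1 0)^-1 *: b) = 1%:M.
  have -> : (- (a 1 0)^-1 *: b)^T = - (a 1 0)^-1 *: b^T by rewrite linearZ.
  rewrite -scalemxAl -scalemxAr [b^T *m b]mx11_scalar -ab.
  rewrite scalerA scale_scalar_mx; congr (_%:M).
  by field.
have [Om [OO dO Oy]] := SO_transitive uu.
pose K := diag_block 1%:M Om.
have kK : K_H (K : 'M[R]_l.-1.+2) by exists Om.
have [q [[s /= s0 qE] qS]] := ray _ kK.
have qE' : q = e_ 1 + (s / a 1 0) *: n.
  rewrite -qE ray_point// mulmxDr -scalemxAr -[g *m o]/(proj g) go.
  have -> : K *m null_dir = (a 1 0)^-1 *: v.
    rewrite null_dirE block_spacetime mul1mx mulmxN Oy scaleNr opprK vE.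
    rewrite spacetimeZ; congr spacetime; apply/colP => i.
    suff [->|->] : i = 0 \/ i = 1.
    - by rewrite [RHS]mxE a0 mulr0 mxE.
    - by rewrite [RHS]mxE mulVf// mxE.
    by case: i => [[|[|i]] hi] //; [left|right]; exact/val_inj.
  by rewrite -scalemxAr gv scalerA.
have [oT oT' _ _ _] := base_lightcone.
have := singularity_lightcone qS.
rewrite qE' !ev_colD !ev_colZ /n !ev_colD oT oT' t_minus_yE t_plus_yE.
rewrite !(evD, evN) !ev_covec_delta//= !subr0 !addr0 mulr0 addr0.
by case=> /eqP; rewrite oner_eq0.
Qed.

Lemma t_axis_event_horizon : event_horizon R l (e_ 1).
Proof.
split; last by move=> /interior_subset; exact: t_axis_not_interior.
pose gam (t : R) : 'cV[R]_k.+4 := cos t *: o + sin t *: e_ 1.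
have gam_pi2 : gam (pi / 2) = e_ 1.
  by rewrite /gam cos_pihalf sin_pihalf scale0r add0r scale1r.
have gamA t : AdS (gam t : 'cV[R]_l.-1.+2).
  have [oT oT' oD oS oi] := base_lightcone.
  apply/AdS_qform; rewrite /qform !ev_colD !ev_colZ oT oT' oD oS.
  rewrite t_minus_yE t_plus_yE u_minus_xE u_plus_xE !(evD, evN).
  rewrite !ev_covec_delta//= big1.
    by rewrite -[RHS](cos2Dsin2 t); ring.
  move=> i _; have hi : (i.+4 < k.+4)%N by rewrite !ltnS.
  rewrite ev_colD !ev_colZ oi// ev_covec_delta//.
  by rewrite !mulr0 addr0 expr0n.
have gamc : gam t @[t --> (pi / 2)^'+] --> (e_ 1 : 'cV[R]_k.+4).
  rewrite -gam_pi2; apply: cvg_at_right_filter.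
  apply: cvgD; (apply: cvgZ; last exact: cvg_cst).
    exact: continuous_cos.
  exact: continuous_sin.
move=> B; rewrite -[nbhs _]/(nbhs_subspace (e_ 1 : subspace (@AdS R l))).
rewrite -nbhs_subspace_in; last by rewrite -gam_pi2.
move=> /gamc nB.
have : \forall t \near (pi / 2)^'+, interior_region (gam t : 'cV[R]_l.-1.+2).
  near=> t.
  have h1 : pi / 2 < t by near: t; exact: nbhs_right_gt.
  have h2 : t < pi.
    near: t; apply: nbhs_right_lt; rewrite ltr_pdivrMr// ltr_pMr ?pi_gt0//.
    by rewrite ltr1n.
  apply: interior_rotation; first exact: cos2Dsin2.
  - rewrite -[cos t]opprK -sinBpihalf oppr_lt0; apply: sin_gt0_pi.
    rewrite subr_gt0 h1 ltrBlDr (lt_trans h2)// ltrDl.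
    by rewrite divr_gt0 ?pi_gt0.
  - apply: sin_gt0_pi; rewrite h2 andbT (lt_trans _ h1)//.
    by rewrite divr_gt0 ?pi_gt0.
  - exact: rotation_G.
move=> iB; near ((pi : R) / 2)^'+ => t; exists (gam t); split.
  by near: t; exact: iB.
have : AdS (gam t : 'cV[R]_l.-1.+2) -> B (gam t) by near: t; exact: nB.
exact.
Unshelve. all: by end_near.
Qed.

End AntiDeSitter.

Theorem proposition11 (R : realType) (l : nat) (hl : (3 <= l)%N) :
  event_horizon R l !=set0.
Proof.
case: l hl => [|[|[|k]]]// _.
by exists (delta_mx (inord 1) 0); exact: t_axis_event_horizon.
Qed.
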